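(* Let $\kappa$ be a perfect field of characteristic $p>0$. The functors $\mathfrak z\mapsto\mathbf F\mathfrak z$ on fat $\kappa$-points and $Y\mapsto\mathfrak F_Y$ on $\kappa$-schemes constitute a sub-schemic adjunction; that is, each $\mathfrak F_Y$ is a sub-schemic motif on $Y$ and $Y(\mathbf F\mathfrak z)\cong\mathfrak F_Y(\mathfrak z)$, functorially in the fat point $\mathfrak z$ and the $\kappa$-scheme $Y$. In particular, there are induced endomorphisms $\nabla_{\mathbf F}$ of the rings $\mathbf{Gr}(\mathrm{subSch}_\kappa)$ and $\mathbf{Gr}(\mathrm{Form}_\kappa)$.
   Context: A $\kappa$-scheme is a separated scheme of finite type over $\kappa$. A fat point is a $\kappa$-scheme $\mathfrak z$, finite over $\kappa$, with a unique point; $\mathrm{Fat}_\kappa$ is the category of fat points and $\kappa$-morphisms. For a $\kappa$-scheme $X$ put $X(\mathfrak z)=\operatorname{Mor}_\kappa(\mathfrak z,X)$ and let $X^\circ$ be the contravariant functor $\mathfrak z\mapsto X(\mathfrak z)$ from $\mathrm{Fat}_\kappa$ to sets. A sieve on $X$ is a subfunctor of $X^\circ$; morphisms of sieves are natural transformations; unions, intersections and products are pointwise. A sub-schemic motif on $X$ is an image sieve $\operatorname{Im}(\varphi)$, $\varphi\colon Y\to X$ a morphism of $\kappa$-schemes, with $\operatorname{Im}(\varphi)(\mathfrak z)$ the image of $Y(\mathfrak z)\to X(\mathfrak z)$; a formal motif is a sieve $\mathfrak X$ such that for each fat point $\mathfrak z$ there is a sub-schemic $\mathfrak Y_{\mathfrak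 z}\subseteq\mathfrak X$ with $\mathfrak Y_{\mathfrak z}(\mathfrak z)=\mathfrak X(\mathfrak z)$. For $\mathbb M$ the class of sub-schemic ($\mathrm{subSch}_\kappa$) or formal ($\mathrm{Form}_\kappa$) motives, $\mathbf{Gr}(\mathbb M)$ is the free abelian group on symbols $\langle\mathfrak X\rangle$, $\mathfrak X\in\mathbb M$, modulo $\langle\mathfrak X\rangle+\langle\mathfrak Y\rangle-\langle\mathfrak X\cup\mathfrak Y\rangle-\langle\mathfrak X\cap\mathfrak Y\rangle$ for $\mathfrak X,\mathfrak Y$ on a common scheme and $\langle\mathfrak X\rangle-\langle\mathfrak Y\rangle$ for isomorphic $\mathfrak X,\mathfrak Y$; multiplication is induced by products. For a fat point $\mathfrak z=\operatorname{Spec}R$, $\mathbf F\mathfrak z$ is the fat point $\operatorname{Spec}(\mathbf FR)$, where $\mathbf FR\subseteq R$ is the $\kappa$-subalgebra of all $p$-th powers of elements of $R$. The inclusion $\mathbf FR\subseteq R$ gives a morphism $\mathfrak z\to\mathbf F\mathfrak z$, hence an injection $Y(\mathbf F\mathfrak z)\to Y(\mathfrak z)$, through which $Y(\mathbf F\mathfrak z)$ is identified with a subset of $Y(\mathfrak z)$. The Frobenius motif $\mathfrak F_Y$: if $Y\subseteq\mathbb A^n_\kappa$ is the closed subscheme with ideal $(f_1,\dots,f_s)\subseteq\kappa[x]$, $x=(x_1,\dots,x_n)$, then $\mathfrak F_Y$ is the image sieve of the morphism $\operatorname{Spec}\kappa[x]/(f_1(x^p),\dots,f_s(x^p))\to Y$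 induced by $x\mapsto x^p=(x_1^p,\dots,x_n^p)$ (this is independent of the embedding); for arbitrary $Y$, $\mathfrak F_Y$ is obtained by gluing over an open affine covering. The adjunction acts on a sieve $\mathfrak Y$ on $Y$ by $(\nabla_{\mathbf F}\mathfrak Y)(\mathfrak z)=\mathfrak Y(\mathbf F\mathfrak z)$ (inside $\mathfrak F_Y(\mathfrak z)$), and $\nabla_{\mathbf F}$ sends $[\mathfrak Y]$ to $[\nabla_{\mathbf F}\mathfrak Y]$. *)

(* Defs.v *)
From HB Require Import structures.
From Stdlib Require Import Ring_theory.
From mathcomp Require Import all_boot all_order all_algebra.
From mathcomp Require Import boolp.
From mathcomp Require Import mpoly.

Set Implicit Arguments.
Unset Strict Implicit.
Unset Printing Implicit Defensive.

Import GRing.Theory.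
Local Open Scope ring_scope.

(* Schemes over a field k are defined by their functors of points, as in
   Demazure-Gabriel, "Groupes algebriques", I, sections 1 and 2: a k-scheme is
   a functor on commutative k-algebras that is a sheaf for the Zariski topology
   and is covered by open affine subfunctors.  The test algebras are the
   [comAlgType k], which are nonzero; the value of a Zariski sheaf on the zero
   algebra is always a point, so nothing is lost. *)

Section Algebra.
Variable k : fieldType.
Implicit Types (R S T : comAlgType k).

Definition is_ideal R (J : R -> Prop) : Prop :=
  [/\ J 0, forall x y, J x -> J y -> J (x + y) & forall a x, J x -> J (a * x)].

(* the ideal of R generated by A is the unit ideal *)
Definition generates_unit R (A : R -> Prop) : Prop :=
  forall J : R -> Prop, is_ideal J -> (forall x, A x -> J x) -> J 1.

Definition prime_ideal R (P : R -> Prop) : Prop :=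
  [/\ is_ideal P, ~ P 1 & forall x y, P (x * y) -> P x \/ P y].

Definition is_field R : Prop := forall x : R, x != 0 -> exists y, x * y = 1.

Definition image_set R S (phi : R -> S) (A : R -> Prop) : S -> Prop :=
  fun s => exists2 r, A r & phi r = s.

(* l exhibits S as the localization R_f *)
Definition is_localization R S (f : R) (l : {lrmorphism R -> S}) : Prop :=
  [/\ exists s, l f * s = 1,
      forall s, exists r n, s * l f ^+ n = l r
    & forall r, l r = 0 -> exists n, f ^+ n * r = 0].

Lemma lrmorphP R S (f g : {lrmorphism R -> S}) : f =1 g -> f = g.
Proof.
case: f g => [f cf] [g cg] /= e.
have e' : f = g by apply: funext.
move: cf cg; rewrite {}e' => cf cg.
case: cf cg => [[h1] [h2] [h3]] [[g1] [g2] [g3]].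
by rewrite (Prop_irrelevance h1 g1) (Prop_irrelevance h2 g2)
  (Prop_irrelevance h3 g3).
Qed.

Definition mev (n : nat) R (a : 'I_n -> R) (f : {mpoly k[n]}) : R :=
  mmap (GRing.in_alg R) a f.

Lemma mev_morph n R S (phi : {lrmorphism R -> S}) (a : 'I_n -> R) f :
  phi (mev a f) = mev (phi \o a) f.
Proof.
rewrite /mev /mmap rmorph_sum; apply: eq_bigr => m _ /=.
rewrite rmorphM /= linearZ /= rmorph1; congr (_ * _).
rewrite /mmap1 rmorph_prod; apply: eq_bigr => i _.
by rewrite rmorphXn.
Qed.

Lemma mev_comp n m R (a : 'I_m -> R) (q : n.-tuple {mpoly k[m]}) f :
  mev a (f \mPo q) = mev (fun i => mev a (tnth q i)) f.
Proof.
rewrite [LHS]/mev comp_mpolyEX /= raddf_sum /= [RHS]/mev /mmap.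
apply: eq_bigr => w _.
rewrite -[LHS]/(mmap (GRing.in_alg R) a (f@_w *: ('X_[w] \mPo q))) mmapZ /=.
congr (_ * _).
rewrite comp_mpolyX rmorph_prod /mmap1; apply: eq_bigr => i _.
by rewrite rmorphXn.
Qed.

Lemma mevX n R (a : 'I_n -> R) i : mev a 'X_i = a i.
Proof. by rewrite /mev mmapX mmap1U. Qed.

Lemma mev_eq n R (a b : 'I_n -> R) f : a =1 b -> mev a f = mev b f.
Proof. by move=> e; congr mev; apply: funext. Qed.

End Algebra.

Section Schemes.
Variable k : fieldType.
Implicit Types (R S T : comAlgType k).

Record kfunctor := KFunctor {
  fobj :> comAlgType k -> Type;
  fmap : forall R S, {lrmorphism R -> S} -> fobj R -> fobj S;
  fmap_id : forall R (x : fobj R), fmap idfun x = x;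
  fmap_comp : forall R S T (f : {lrmorphism R -> S}) (g : {lrmorphism S -> T})
    (x : fobj R), fmap (g \o f) x = fmap g (fmap f x) }.
Arguments fmap X {R S} f x : rename.
Implicit Types X Y Z U W : kfunctor.

Record kmor X Y := KMor {
  app :> forall R, X R -> Y R;
  app_nat : forall R S (f : {lrmorphism R -> S}) (x : X R),
    app (fmap X f x) = fmap Y f (app x) }.

Lemma kmorP X Y (f g : kmor X Y) : (forall R (x : X R), f R x = g R x) -> f = g.
Proof.
case: f g => [f hf] [g hg] /= e.
have e' : f = g by apply: functional_extensionality_dep => R; apply: funext.
by subst g; rewrite (Prop_irrelevance hf hg).
Qed.

Definition kid X : kmor X X.
Proof. by exists (fun R x => x). Defined.

Definition kcomp X Y Z (g : kmor Y Z) (f : kmor X Y) : kmor X Z.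
Proof. by exists (fun R x => g R (f R x)) => R S h x; rewrite !app_nat. Defined.

Lemma kcompA X Y Z W (h : kmor Z W) (g : kmor Y Z) (f : kmor X Y) :
  kcomp h (kcomp g f) = kcomp (kcomp h g) f.
Proof. exact: kmorP. Qed.

Lemma kcomp1 X Y (f : kmor X Y) : kcomp f (kid X) = f.
Proof. exact: kmorP. Qed.

Lemma kcomp_1 X Y (f : kmor X Y) : kcomp (kid Y) f = f.
Proof. exact: kmorP. Qed.

Definition Spec (A : comAlgType k) : kfunctor.
Proof.
exists (fun R => {lrmorphism A -> R}) (fun R S f g => f \o g).
- by move=> R x; apply: lrmorphP.
- by move=> *; apply: lrmorphP.
Defined.

Definition Spec_map (A B : comAlgType k) (f : {lrmorphism A -> B}) :
  kmor (Spec B) (Spec A).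
Proof.
exists (fun R (g : {lrmorphism B -> R}) => g \o f : {lrmorphism A -> R}).
by move=> R S h g; apply: lrmorphP.
Defined.

(* the homomorphism of algebras inducing a given morphism of affine schemes *)
Definition Spec_hom (A B : comAlgType k) (f : kmor (Spec B) (Spec A)) :
  {lrmorphism A -> B} := f B idfun.

(* The closed subscheme of affine n-space with ideal generated by fs, that is,
   Spec k[x]/(fs): its R-points are the zeros of fs in R^n. *)
Definition zeros n (fs : seq {mpoly k[n]}) R (a : 'I_n -> R) : Prop :=
  forall f, f \in fs -> mev a f = 0.

Lemma zeros_morph n (fs : seq {mpoly k[n]}) R S (phi : {lrmorphism R -> S})
  (a : 'I_n -> R) : zeros fs a -> zeros fs (phi \o a).
Proof. by move=> h f /h e; rewrite -mev_morph e rmorph0. Qed.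

Lemma zerosP n (fs : seq {mpoly k[n]}) R
  (u v : {a : 'I_n -> R | zeros fs a}) : sval u =1 sval v -> u = v.
Proof.
case: u v => [a ha] [b hb] /= e; have e' : a = b by apply: funext.
by subst b; rewrite (Prop_irrelevance ha hb).
Qed.

Definition closed_sub n (fs : seq {mpoly k[n]}) : kfunctor.
Proof.
exists (fun R => {a : 'I_n -> R | zeros fs a})
  (fun R S (phi : {lrmorphism R -> S}) u =>
     exist _ (phi \o sval u) (zeros_morph phi (svalP u))).
- by move=> R x; apply: zerosP.
- by move=> *; apply: zerosP.
Defined.

(* For every x in X(R) there is an ideal I of R (here given by generators) such
   that, for phi : R -> S, the image of x in X(S) comes from U iff IS = S. *)
Definition open_immersion U X (u : kmor U X) : Prop :=
  (forall R, injective (u R)) /\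
  (forall R (x : X R), exists I : R -> Prop,
     forall S (phi : {lrmorphism R -> S}),
       (exists y : U S, u S y = fmap X phi x) <->
       generates_unit (image_set phi I)).

(* an open affine of finite type over k *)
Record chart X := Chart {
  chart_dim : nat;
  chart_eqs : seq {mpoly k[chart_dim]};
  chart_map : kmor (closed_sub chart_eqs) X;
  chart_open : open_immersion chart_map }.

(* open subfunctors form a covering when they do so on points with values in
   fields *)
Definition covers X (C : chart X -> Prop) : Prop :=
  forall K : comAlgType k, is_field K -> forall x : X K,
    exists2 c, C c & exists y, chart_map c K y = x.

Definition zariski_sheaf X : Prop :=
  forall R m (f : 'I_m -> R) (S : 'I_m -> comAlgType k)
         (l : forall i, {lrmorphism R -> S i}),
    generates_unit (fun r => exists i, f i = r) ->
    (forall i, is_localization (f i) (l i)) ->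
    forall x : (forall i, X (S i)),
      (forall i j T (u : {lrmorphism S i -> T}) (v : {lrmorphism S j -> T}),
         u \o l i =1 v \o l j -> fmap X u (x i) = fmap X v (x j)) ->
      exists! y : X R, forall i, fmap X (l i) y = x i.

(* the diagonal of X is a closed immersion *)
Definition separated X : Prop :=
  forall R (x y : X R), exists I : R -> Prop,
    forall S (phi : {lrmorphism R -> S}),
      fmap X phi x = fmap X phi y <-> (forall r, I r -> phi r = 0).

Record is_kscheme X : Prop := IsKScheme {
  ksch_sheaf : zariski_sheaf X;
  ksch_cover : exists (I : finType) (c : I -> chart X),
    covers (fun d => exists i, c i = d);
  ksch_sep : separated X }.

Record kscheme := KScheme { kfun :> kfunctor; kschP : is_kscheme kfun }.

Definition prodf X Y : kfunctor.
Proof.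
exists (fun R => (X R * Y R)%type)
  (fun R S phi x => (fmap X phi x.1, fmap Y phi x.2)).
- by move=> R [x y]; rewrite !fmap_id.
- by move=> R S T f g [x y]; rewrite !fmap_comp.
Defined.

Definition fstf X Y : kmor (prodf X Y) X.
Proof. by exists (fun R x => x.1). Defined.

Definition sndf X Y : kmor (prodf X Y) Y.
Proof. by exists (fun R x => x.2). Defined.

Definition pairf Z X Y (f : kmor Z X) (g : kmor Z Y) : kmor Z (prodf X Y).
Proof.
by exists (fun R z => (f R z, g R z)) => R S h z; rewrite !app_nat.
Defined.

Lemma fst_pair Z X Y (f : kmor Z X) (g : kmor Z Y) :
  kcomp (fstf X Y) (pairf f g) = f.
Proof. exact: kmorP. Qed.

Lemma snd_pair Z X Y (f : kmor Z X) (g : kmor Z Y) :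
  kcomp (sndf X Y) (pairf f g) = g.
Proof. exact: kmorP. Qed.

Lemma pairf_comp W Z X Y (f : kmor Z X) (g : kmor Z Y) (h : kmor W Z) :
  kcomp (pairf f g) h = pairf (kcomp f h) (kcomp g h).
Proof. exact: kmorP. Qed.

Lemma prodf_sheaf X Y : zariski_sheaf X -> zariski_sheaf Y ->
  zariski_sheaf (prodf X Y).
Proof.
move=> hX hY R m f S l hf hl z hz.
have [|x [hx ux]] := hX R m f S l hf hl (fun i => (z i).1).
  by move=> i j T u v e; have [] := hz i j T u v e.
have [|y [hy uy]] := hY R m f S l hf hl (fun i => (z i).2).
  by move=> i j T u v e; have [] := hz i j T u v e.
exists (x, y); split=> [i|[x' y'] h]; first by rewrite /= hx hy; case: (z i).
by congr pair; [apply: ux => i|apply: uy => i]; rewrite -(h i).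
Qed.

Lemma prodf_sep X Y : separated X -> separated Y -> separated (prodf X Y).
Proof.
move=> hX hY R [x y] [x' y']; have [I hI] := hX R x x'.
have [J hJ] := hY R y y'; exists (fun r => I r \/ J r) => S phi /=; split.
  by case=> /hI h1 /hJ h2 r [/h1|/h2].
by move=> h; congr pair; [apply/hI|apply/hJ] => r hr; apply: h; [left|right].
Qed.

Lemma prodf_open U V X Y (u : kmor U X) (v : kmor V Y) W
  (w : kmor W (prodf X Y)) :
  open_immersion u -> open_immersion v ->
  (forall R, injective (w R)) ->
  (forall R x y, (exists z, w R z = (x, y)) <->
     (exists s, u R s = x) /\ (exists t, v R t = y)) ->
  open_immersion w.
Proof.
move=> [_ ou] [_ ov] iw hw; split=> // R [x y].
have [I hI] := ou R x; have [J hJ] := ov R y.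
exists (fun r => exists i j, [/\ I i, J j & r = i * j]) => S phi.
have -> : (exists z, w S z = fmap (prodf X Y) phi (x, y)) <->
    (exists s, u S s = fmap X phi x) /\ (exists t, v S t = fmap Y phi y).
  exact: hw.
split.
  case=> /hI hi /hJ hj A [A0 AD AM] hA.
  apply: hi => // s [i Ii <-].
  have := hj (fun s => A (phi i * s)); rewrite mulr1; apply.
    split; first by rewrite mulr0.
      by move=> a b; rewrite mulrDr; apply: AD.
    by move=> a b; rewrite mulrCA; apply: AM.
  move=> t [j Jj <-]; apply: hA; exists (i * j); last by rewrite rmorphM.
  by exists i, j.
move=> h; split; [apply/hI|apply/hJ] => A [A0 AD AM] hA; apply: h => //.
  move=> s [_ [i [j [Ii Jj ->]]] <-].
  by rewrite rmorphM mulrC; apply: AM; apply: hA; exists i.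
move=> s [_ [i [j [Ii Jj ->]]] <-].
by rewrite rmorphM; apply: AM; apply: hA; exists j.
Qed.

Section ProdChart.
Variables (n m : nat) (fs : seq {mpoly k[n]}) (gs : seq {mpoly k[m]}).

Definition prod_eqs : seq {mpoly k[n + m]} :=
  [seq f \mPo [tuple 'X_(lshift m i) | i < n] | f <- fs] ++
  [seq g \mPo [tuple 'X_(rshift n i) | i < m] | g <- gs].

Lemma prod_eqsP R (c : 'I_(n + m) -> R) : zeros prod_eqs c <->
  zeros fs (c \o lshift m) /\ zeros gs (c \o @rshift n m).
Proof.
have El f : mev c (f \mPo [tuple 'X_(lshift m i) | i < n]) =
    mev (c \o lshift m) f.
  by rewrite mev_comp; apply: mev_eq => i; rewrite tnth_mktuple mevX.
have Er g : mev c (g \mPo [tuple 'X_(rshift n i) | i < m]) =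
    mev (c \o @rshift n m) g.
  by rewrite mev_comp; apply: mev_eq => i; rewrite tnth_mktuple mevX.
split.
  move=> h; split=> f hf.
    by rewrite -El; apply: h; rewrite mem_cat map_f.
  by rewrite -Er; apply: h; rewrite mem_cat map_f ?orbT.
case=> h1 h2 q; rewrite mem_cat => /orP[] /mapP[f hf ->].
  by rewrite El h1.
by rewrite Er h2.
Qed.

Definition prod_split : kmor (closed_sub prod_eqs)
  (prodf (closed_sub fs) (closed_sub gs)).
Proof.
exists (fun R (c : closed_sub prod_eqs R) =>
  (exist _ _ (proj1 (proj1 (prod_eqsP _) (svalP c))),
   exist _ _ (proj2 (proj1 (prod_eqsP _) (svalP c))))).
by move=> R S f c; congr pair; apply: zerosP.
Defined.

Lemma prod_split_inj R : injective (prod_split R).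
Proof.
move=> [c hc] [d hd] [e1 e2]; apply: zerosP => i /=.
by case: (split_ordP i) => j ->; [have := congr1 (@^~ j) e1|
  have := congr1 (@^~ j) e2].
Qed.

Lemma prod_split_surj R a b : exists c, prod_split R c = (a, b).
Proof.
pose c := fun i : 'I_(n + m) =>
  match split i with inl j => sval a j | inr j => sval b j end.
have cl : c \o lshift m = sval a.
  by apply: funext => j; rewrite /c /= (unsplitK (inl j)).
have cr : c \o @rshift n m = sval b.
  by apply: funext => j; rewrite /c /= (unsplitK (inr j)).
have hc : zeros prod_eqs c.
  by apply/prod_eqsP; rewrite cl cr; split; apply: svalP.
exists (exist _ c hc); congr pair; apply: zerosP => i /=.
  by rewrite -cl.
by rewrite -cr.
Qed.

End ProdChart.

Definition prod_mor U V X Y (u : kmor U X) (v : kmor V Y) :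
    kmor (prodf U V) (prodf X Y) :=
  pairf (kcomp u (fstf U V)) (kcomp v (sndf U V)).

Definition prod_chart X Y (c : chart X) (d : chart Y) : chart (prodf X Y).
Proof.
exists (chart_dim c + chart_dim d)%N (prod_eqs (chart_eqs c) (chart_eqs d))
  (kcomp (prod_mor (chart_map c) (chart_map d)) (prod_split _ _)).
apply: (prodf_open (chart_open c) (chart_open d)).
  move=> R x y /= [].
  move=> /(proj1 (chart_open c)) e1 /(proj1 (chart_open d)) e2.
  by apply: prod_split_inj; congr pair.
move=> R x y; split.
  by case=> z [<- <-]; split; eexists.
case=> -[s <-] [t <-].
by have [z hz] := prod_split_surj s t; exists z; rewrite /= in hz *; case: hz => <- <-.
Defined.

Lemma prod_is_kscheme X Y : is_kscheme X -> is_kscheme Y ->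
  is_kscheme (prodf X Y).
Proof.
move=> [shX [I [c hc]] sepX] [shY [J [d hd]] sepY]; split.
- exact: prodf_sheaf.
- exists (I * J)%type, (fun ij => prod_chart (c ij.1) (d ij.2)).
  move=> K fK [x y]; have [_ [i <-] [s hs]] := hc K fK x.
  have [_ [j <-] [t ht]] := hd K fK y; exists (prod_chart (c i) (d j)).
    by exists (i, j).
  have [z hz] := prod_split_surj s t; exists z; rewrite /= in hz *.
  by case: hz => -> ->; rewrite hs ht.
- exact: prodf_sep.
Qed.

Definition kprod (X Y : kscheme) : kscheme :=
  KScheme (prod_is_kscheme (kschP X) (kschP Y)).

Definition pointf : kfunctor.
Proof. by exists (fun _ => unit) (fun _ _ _ u => u). Defined.

Lemma point_is_kscheme : is_kscheme pointf.
Proof.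
have z0 R (a : 'I_0 -> R) : @zeros 0 [::] R a by move=> f.
have a0 T : 'I_0 -> T by case.
pose pm : kmor (@closed_sub 0 [::]) pointf :=
  @KMor (closed_sub _) pointf (fun R _ => tt) (fun _ _ _ _ => erefl).
have po : open_immersion pm.
  split=> [R a b _|R []]; first by apply: zerosP => -[].
  exists (fun r => r = 1) => S phi; split=> [_ J _ h|_].
    by apply: h; exists 1 => //; rewrite rmorph1.
  by exists (exist _ (a0 S) (z0 S (a0 S))).
split.
- by move=> R m f S l _ _ x _; exists tt; split=> [i|[]] //; case: (x i).
- exists unit, (fun _ => Chart po) => K _ []; exists (Chart po); first by exists tt.
  by exists (exist _ (a0 K) (z0 K (a0 K))).
- by move=> R [] []; exists (fun _ => False).
Qed.

(* Spec k *)
Definition kpoint : kscheme := KScheme point_is_kscheme.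

End Schemes.
Arguments fmap {k} X {R S} f x : rename.

Section Sieves.
Variable k : fieldType.

Definition finite_over_k (R : comAlgType k) : Prop :=
  exists s : seq R, forall x : R, exists c : seq k,
    x = \sum_(i < size s) c`_i *: s`_i.

Definition unique_prime (R : comAlgType k) : Prop :=
  (exists P : R -> Prop, prime_ideal P) /\
  (forall P Q : R -> Prop, prime_ideal P -> prime_ideal Q ->
     forall x, P x <-> Q x).

(* The fat point Spec R, recorded by its algebra R; its unique point is the
   unique prime ideal of R.  Fat points form a full subcategory of k-schemes. *)
Record fat := Fat {
  fat_alg :> comAlgType k;
  fat_finite : finite_over_k fat_alg;
  fat_local : unique_prime fat_alg }.

Definition fatmor (z z' : fat) : Type := kmor (Spec z) (Spec z').

Definition pts (X : kscheme k) (z : fat) : Type := kmor (Spec z) X.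

Record sieve (X : kscheme k) := Sieve {
  smem :> forall z : fat, pts X z -> Prop;
  smem_comp : forall z z' (a : fatmor z' z) (x : pts X z),
    smem x -> smem (kcomp x a) }.

Lemma sieveP X (A B : sieve X) : (forall z (x : pts X z), A z x <-> B z x) ->
  A = B.
Proof.
case: A B => [A hA] [B hB] /= e.
have e' : A = B.
  apply: functional_extensionality_dep => z; apply: funext => x.
  by apply/propext.
by subst B; rewrite (Prop_irrelevance hA hB).
Qed.

Definition sieve_cup X (A B : sieve X) : sieve X.
Proof.
exists (fun z x => A z x \/ B z x).
by move=> z z' a x [h|h]; [left|right]; apply: smem_comp.
Defined.

Definition sieve_cap X (A B : sieve X) : sieve X.
Proof.
exists (fun z x => A z x /\ B z x).
by move=> z z' a x [h h']; split; apply: smem_comp.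
Defined.

Definition sieve_full X : sieve X.
Proof. by exists (fun z x => True). Defined.

Definition sieve_prod X Y (A : sieve X) (B : sieve Y) : sieve (kprod X Y).
Proof.
exists (fun z x => A z (kcomp (fstf X Y) x) /\ B z (kcomp (sndf X Y) x)).
by move=> z z' a x [h h']; rewrite !kcompA; split; apply: smem_comp.
Defined.

Record sieve_mor X Y (A : sieve X) (B : sieve Y) := SieveMor {
  sapp :> forall z, {x : pts X z | A z x} -> {y : pts Y z | B z y};
  sapp_nat : forall z z' (a : fatmor z' z) (x : {x : pts X z | A z x}),
    sval (sapp (exist _ _ (smem_comp a (svalP x)))) =
    kcomp (sval (sapp x)) a }.

Definition sieve_iso X Y (A : sieve X) (B : sieve Y) : Prop :=
  exists (f : sieve_mor A B) (g : sieve_mor B A),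
    (forall z x, g z (f z x) = x) /\ (forall z y, f z (g z y) = y).

Lemma sieve_sigP X (A : sieve X) z (u v : {x : pts X z | A z x}) :
  sval u = sval v -> u = v.
Proof.
by case: u v => u hu [v hv] /= e; subst v; rewrite (Prop_irrelevance hu hv).
Qed.

Lemma sieve_iso_refl X (A : sieve X) : sieve_iso A A.
Proof. by do 2!(exists (@SieveMor _ _ A A (fun z x => x) (fun _ _ _ _ => erefl))). Qed.

(* two sieves correspond under an isomorphism of the ambient schemes *)
Lemma sieve_iso_sch X Y (A : sieve X) (B : sieve Y) (f : kmor X Y)
    (g : kmor Y X) :
  (forall R x, g R (f R x) = x) -> (forall R y, f R (g R y) = y) ->
  (forall z (x : pts X z), A z x <-> B z (kcomp f x)) -> sieve_iso A B.
Proof.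
move=> gf fg AB.
have BA z (y : pts Y z) : B z y -> A z (kcomp g y).
  move=> h; apply/AB; have -> // : kcomp f (kcomp g y) = y.
  by apply: kmorP => R t; apply: fg.
exists (@SieveMor _ _ A B
  (fun z x => exist _ (kcomp f (sval x)) (proj1 (AB _ _) (svalP x)))
  (fun _ _ _ _ => kcompA _ _ _)).
exists (@SieveMor _ _ B A
  (fun z y => exist _ (kcomp g (sval y)) (BA _ _ (svalP y)))
  (fun _ _ _ _ => kcompA _ _ _)).
by split=> z x; apply: sieve_sigP; apply: kmorP => R t; [apply: gf|apply: fg].
Qed.

Lemma sieve_prod_iso X X' Y Y' (A : sieve X) (A' : sieve X') (B : sieve Y)
    (B' : sieve Y') :
  sieve_iso A A' -> sieve_iso B B' ->
  sieve_iso (sieve_prod A B) (sieve_prod A' B').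
Proof.
have bld X1 X2 Y1 Y2 (A1 : sieve X1) (A2 : sieve X2) (B1 : sieve Y1)
    (B2 : sieve Y2) (f : sieve_mor A1 A2) (g : sieve_mor B1 B2) :
    exists h : sieve_mor (sieve_prod A1 B1) (sieve_prod A2 B2),
    forall z x, sval (h z x) =
      pairf (sval (f z (exist _ _ (proj1 (svalP x)))))
            (sval (g z (exist _ _ (proj2 (svalP x))))).
  have hP z (x : {x | sieve_prod A1 B1 z x}) :
      sieve_prod A2 B2 z (pairf (sval (f z (exist _ _ (proj1 (svalP x)))))
            (sval (g z (exist _ _ (proj2 (svalP x)))))).
    by split; rewrite ?fst_pair ?snd_pair; apply: svalP.
  have nat z z' (a : fatmor z' z) (x : {x | sieve_prod A1 B1 z x}) :
     sval (exist _ _ (hP z' (exist _ _ (smem_comp a (svalP x))))) =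
     kcomp (sval (exist _ _ (hP z x))) a.
    rewrite /= pairf_comp -!sapp_nat; congr pairf; congr sval.
      by congr (f z'); apply: sieve_sigP => /=; rewrite kcompA.
    by congr (g z'); apply: sieve_sigP => /=; rewrite kcompA.
  by exists (@SieveMor _ _ (sieve_prod A1 B1) (sieve_prod A2 B2)
    (fun z x => exist _ _ (hP z x)) nat).
move=> [f [f' [ff' f'f]]] [g [g' [gg' g'g]]].
have [h hE] := bld _ _ _ _ _ _ _ _ f g.
have [h' h'E] := bld _ _ _ _ _ _ _ _ f' g'.
exists h, h'; split=> z x; apply: sieve_sigP.
  rewrite h'E.
  set u := exist _ _ _; set v := exist _ _ _.
  have -> : u = f z (exist _ _ (proj1 (svalP x))).
    by apply: sieve_sigP; rewrite /u /= hE; apply: kmorP.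
  have -> : v = g z (exist _ _ (proj2 (svalP x))).
    by apply: sieve_sigP; rewrite /v /= hE; apply: kmorP.
  rewrite ff' gg' /=; apply: kmorP => R t /=.
  by rewrite -surjective_pairing.
rewrite hE.
set u := exist _ _ _; set v := exist _ _ _.
have -> : u = f' z (exist _ _ (proj1 (svalP x))).
  by apply: sieve_sigP; rewrite /u /= h'E; apply: kmorP.
have -> : v = g' z (exist _ _ (proj2 (svalP x))).
  by apply: sieve_sigP; rewrite /v /= h'E; apply: kmorP.
rewrite f'f g'g /=; apply: kmorP => R t /=.
by rewrite -surjective_pairing.
Qed.

Definition image_sieve (Y X : kscheme k) (phi : kmor Y X) : sieve X.
Proof.
exists (fun z x => exists y : pts Y z, kcomp phi y = x).
by move=> z z' a _ [y <-]; exists (kcomp y a); rewrite kcompA.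
Defined.

Definition sub_schemic X (A : sieve X) : Prop :=
  exists (Y : kscheme k) (phi : kmor Y X), A = image_sieve phi.

Definition formal X (A : sieve X) : Prop :=
  forall z : fat, exists B : sieve X,
    [/\ sub_schemic B, forall w x, B w x -> A w x
      & forall x, B z x <-> A z x].

(* A class of motives closed under products and containing Spec k. *)
Record motif_class := MotifClass {
  is_motif :> forall X, sieve X -> Prop;
  motif_prod : forall X Y (A : sieve X) (B : sieve Y),
    is_motif A -> is_motif B -> is_motif (sieve_prod A B);
  motif_unit : is_motif (sieve_full (kpoint k)) }.

Lemma sub_schemic_prod X Y (A : sieve X) (B : sieve Y) :
  sub_schemic A -> sub_schemic B -> sub_schemic (sieve_prod A B).
Proof.
move=> [X' [f ->]] [Y' [g ->]]; exists (kprod X' Y'), (prod_mor f g).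
apply: sieveP => z x /=; split.
  case=> -[a ha] [b hb]; exists (pairf a b); apply: kmorP => R t.
  rewrite [RHS]surjective_pairing.
  rewrite -[(x R t).1]/(kcomp (fstf X Y) x R t) -ha.
  by rewrite -[(x R t).2]/(kcomp (sndf X Y) x R t) -hb.
case=> y <-; split.
  by exists (kcomp (fstf X' Y') y); apply: kmorP.
by exists (kcomp (sndf X' Y') y); apply: kmorP.
Qed.

Lemma sub_schemic_full X : sub_schemic (sieve_full X).
Proof.
exists X, (kid X); apply: sieveP => z x; split=> // _.
by exists x; rewrite kcomp_1.
Qed.

Lemma formal_prod X Y (A : sieve X) (B : sieve Y) :
  formal A -> formal B -> formal (sieve_prod A B).
Proof.
move=> hA hB z; have [A' [sA iA eA]] := hA z; have [B' [sB iB eB]] := hB z.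
exists (sieve_prod A' B'); split; first exact: sub_schemic_prod.
  by move=> w x [/iA ? /iB ?].
by move=> x; split=> -[/eA ? /eB ?].
Qed.

Lemma formal_full X : formal (sieve_full X).
Proof. by move=> z; exists (sieve_full X); split=> //; apply: sub_schemic_full. Qed.

Definition subSch : motif_class :=
  MotifClass sub_schemic_prod (sub_schemic_full (kpoint k)).

Definition Form : motif_class :=
  MotifClass formal_prod (formal_full (kpoint k)).

End Sieves.

(* Gr(M) as a setoid: formal expressions in the symbols, modulo the congruence
   generated by the axioms of abelian groups and the two families of relations.
   (It is not a MathComp ring: the symbols quantify over all k-schemes, so the
   carrier lives in a larger universe.)  The product is the biadditive extension
   of the product of motives; see [gr_ring]. *)
Section Grothendieck.
Variable k : fieldType.
Variable M : motif_class k.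

Record motif := Motif {
  motif_sch : kscheme k;
  motif_sieve : sieve motif_sch;
  motifP : M _ motif_sieve }.

Inductive gr : Type :=
| gr_sym of motif
| gr_zero
| gr_add of gr & gr
| gr_opp of gr.

Inductive gr_eq : gr -> gr -> Prop :=
| gr_refl a : gr_eq a a
| gr_symm a b : gr_eq a b -> gr_eq b a
| gr_trans a b c : gr_eq a b -> gr_eq b c -> gr_eq a c
| gr_addE a a' b b' : gr_eq a a' -> gr_eq b b' ->
    gr_eq (gr_add a b) (gr_add a' b')
| gr_oppE a a' : gr_eq a a' -> gr_eq (gr_opp a) (gr_opp a')
| gr_addA a b c : gr_eq (gr_add a (gr_add b c)) (gr_add (gr_add a b) c)
| gr_addC a b : gr_eq (gr_add a b) (gr_add b a)
| gr_add0 a : gr_eq (gr_add gr_zero a) a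
| gr_addN a : gr_eq (gr_add a (gr_opp a)) gr_zero
| gr_scissor X (A B : sieve X) (hA : M _ A) (hB : M _ B)
    (hU : M _ (sieve_cup A B)) (hI : M _ (sieve_cap A B)) :
    gr_eq (gr_add (gr_sym (Motif hA)) (gr_sym (Motif hB)))
          (gr_add (gr_sym (Motif hU)) (gr_sym (Motif hI)))
| gr_iso X Y (A : sieve X) (B : sieve Y) (hA : M _ A) (hB : M _ B) :
    sieve_iso A B -> gr_eq (gr_sym (Motif hA)) (gr_sym (Motif hB)).

Definition gr_sub a b := gr_add a (gr_opp b).

Definition motif_mul (a b : motif) : motif :=
  Motif (motif_prod (motifP a) (motifP b)).

Definition gr_one : gr := gr_sym (Motif (motif_unit M)).

Fixpoint gr_mulr (a : motif) (y : gr) : gr :=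
  match y with
  | gr_sym b => gr_sym (motif_mul a b)
  | gr_zero => gr_zero
  | gr_add y1 y2 => gr_add (gr_mulr a y1) (gr_mulr a y2)
  | gr_opp y1 => gr_opp (gr_mulr a y1)
  end.

Fixpoint gr_mul (x y : gr) : gr :=
  match x with
  | gr_sym a => gr_mulr a y
  | gr_zero => gr_zero
  | gr_add x1 x2 => gr_add (gr_mul x1 y) (gr_mul x2 y)
  | gr_opp x1 => gr_opp (gr_mul x1 y)
  end.

Lemma gr_addACA a b c d :
  gr_eq (gr_add (gr_add a b) (gr_add c d)) (gr_add (gr_add a c) (gr_add b d)).
Proof.
apply: gr_trans (gr_symm (gr_addA _ _ _)) _.
apply: gr_trans (gr_addE (gr_refl a) _) (gr_addA _ _ _).
apply: gr_trans (gr_addA _ _ _) _.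
apply: gr_trans (gr_addE (gr_addC _ _) (gr_refl _)) _.
exact: gr_symm (gr_addA _ _ _).
Qed.

Lemma gr_opp_unique a b : gr_eq (gr_add a b) gr_zero -> gr_eq b (gr_opp a).
Proof.
move=> h; apply: gr_trans (gr_symm (gr_add0 _)) _.
apply: gr_trans (gr_addE (gr_symm (gr_addN a)) (gr_refl _)) _.
apply: gr_trans (gr_addE (gr_addC _ _) (gr_refl _)) _.
apply: gr_trans (gr_symm (gr_addA _ _ _)) _.
apply: gr_trans (gr_addE (gr_refl _) h) _.
by apply: gr_trans (gr_addC _ _) _; apply: gr_add0.
Qed.

Lemma gr_oppD a b :
  gr_eq (gr_add (gr_opp a) (gr_opp b)) (gr_opp (gr_add a b)).
Proof.
apply: gr_opp_unique; apply: gr_trans (gr_addACA _ _ _ _) _.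
by apply: gr_trans (gr_addE (gr_addN _) (gr_addN _)) _; apply: gr_add0.
Qed.

Lemma gr_opp0 : gr_eq (gr_opp gr_zero) gr_zero.
Proof. by apply: gr_symm; apply: gr_opp_unique; apply: gr_add0. Qed.

Lemma gr_sym_eq X (A B : sieve X) (hA : M _ A) (hB : M _ B) :
  A = B -> gr_eq (gr_sym (Motif hA)) (gr_sym (Motif hB)).
Proof.
by move=> e; subst B; apply: gr_iso; apply: sieve_iso_refl.
Qed.

Lemma gr_scissor_gen X (A B U I : sieve X) (hA : M _ A) (hB : M _ B)
    (hU : M _ U) (hI : M _ I) : U = sieve_cup A B -> I = sieve_cap A B ->
  gr_eq (gr_add (gr_sym (Motif hA)) (gr_sym (Motif hB)))
        (gr_add (gr_sym (Motif hU)) (gr_sym (Motif hI))).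
Proof. by move=> eU eI; subst U I; apply: gr_scissor. Qed.

Lemma gr_mulr_eq a y y' : gr_eq y y' -> gr_eq (gr_mulr a y) (gr_mulr a y').
Proof.
elim=> {y y'} /=.
- by move=> y; apply: gr_refl.
- by move=> y y' _; apply: gr_symm.
- by move=> y1 y2 y3 _ h1 _ h2; apply: gr_trans h1 h2.
- by move=> *; apply: gr_addE.
- by move=> *; apply: gr_oppE.
- by move=> *; apply: gr_addA.
- by move=> *; apply: gr_addC.
- by move=> *; apply: gr_add0.
- by move=> *; apply: gr_addN.
- move=> X A B hA hB hU hI; apply: gr_scissor_gen; apply: sieveP => z x /=.
    by tauto.
  by tauto.
- move=> X Y A B hA hB h; apply: gr_iso.
  by apply: sieve_prod_iso => //; apply: sieve_iso_refl.
Qed.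

Lemma gr_mulC x y : gr_eq (gr_mul x y) (gr_mul y x).
Proof.
elim: x => [a||x1 h1 x2 h2|x h] /=.
- elim: y => [b||y1 h1 y2 h2|y h] /=; [|exact: gr_refl|exact: gr_addE|
    exact: gr_oppE].
  apply: gr_iso; pose X := motif_sch a; pose Y := motif_sch b.
  apply: (@sieve_iso_sch _ (kprod X Y) (kprod Y X) _ _ (pairf (sndf X Y) (fstf X Y))
            (pairf (sndf Y X) (fstf Y X))) => [R []|R []|z x] //=.
  rewrite -[X in _ <-> X]/(_ /\ _).
  have -> : kcomp (fstf Y X) (kcomp (pairf (sndf X Y) (fstf X Y)) x) =
     kcomp (sndf X Y) x by apply: kmorP.
  have -> : kcomp (sndf Y X) (kcomp (pairf (sndf X Y) (fstf X Y)) x) =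
     kcomp (fstf X Y) x by apply: kmorP.
  by split=> -[].
- elim: y => [b||y1 h1 y2 h2|y h] /=; try exact: gr_refl.
    apply: gr_trans (gr_symm (gr_add0 _)) _.
    exact: gr_addE.
  by apply: gr_trans (gr_symm gr_opp0) _; apply: gr_oppE.
- apply: gr_trans (gr_addE h1 h2) _ => {h1 h2}.
  elim: y => [b||y1 h1 y2 h2|y h] /=; [exact: gr_refl|exact: gr_add0| |].
    by apply: gr_trans (gr_addACA _ _ _ _) _; apply: gr_addE.
  by apply: gr_trans (gr_oppD _ _) _; apply: gr_oppE.
- apply: gr_trans (gr_oppE h) _ => {h}.
  elim: y => [b||y1 h1 y2 h2|y h] /=; [exact: gr_refl|exact: gr_opp0| |].
    by apply: gr_trans (gr_symm (gr_oppD _ _)) _; apply: gr_addE.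
  exact: gr_oppE.
Qed.

Lemma gr_mul_eqr x y y' : gr_eq y y' -> gr_eq (gr_mul x y) (gr_mul x y').
Proof.
move=> e; elim: x => [a||x1 h1 x2 h2|x h] /=; [exact: gr_mulr_eq|
  exact: gr_refl|exact: gr_addE|exact: gr_oppE].
Qed.

Lemma gr_mul_eq x x' y y' : gr_eq x x' -> gr_eq y y' ->
  gr_eq (gr_mul x y) (gr_mul x' y').
Proof.
move=> ex ey; apply: gr_trans (gr_mul_eqr x ey) _.
apply: gr_trans (gr_mulC _ _) _; apply: gr_trans (gr_mulC _ _).
exact: gr_mul_eqr.
Qed.

Lemma gr_mulA x y z :
  gr_eq (gr_mul x (gr_mul y z)) (gr_mul (gr_mul x y) z).
Proof.
elim: x => [a||x1 h1 x2 h2|x h] /=; [|exact: gr_refl|exact: gr_addE|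
  exact: gr_oppE].
elim: y => [b||y1 h1 y2 h2|y h] /=; [|exact: gr_refl|exact: gr_addE|
  exact: gr_oppE].
elim: z => [c||z1 h1 z2 h2|z h] /=; [|exact: gr_refl|exact: gr_addE|
  exact: gr_oppE].
apply: gr_iso.
pose X := motif_sch a; pose Y := motif_sch b; pose Z := motif_sch c.
pose f : kmor (prodf X (prodf Y Z)) (prodf (prodf X Y) Z) :=
  pairf (pairf (fstf _ _) (kcomp (fstf _ _) (sndf _ _)))
        (kcomp (sndf _ _) (sndf _ _)).
pose g : kmor (prodf (prodf X Y) Z) (prodf X (prodf Y Z)) :=
  pairf (kcomp (fstf _ _) (fstf _ _))
        (pairf (kcomp (sndf _ _) (fstf _ _)) (sndf _ _)).
apply: (@sieve_iso_sch _ (kprod X (kprod Y Z)) (kprod (kprod X Y) Z) _ _ f g) => [R [? []]|R [[]]|z x] //=.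
rewrite !kcompA.
have -> : kcomp (kcomp (kcomp (fstf X Y) (fstf (prodf X Y) Z)) f) x =
   kcomp (fstf X (prodf Y Z)) x by apply: kmorP.
have -> : kcomp (kcomp (kcomp (sndf X Y) (fstf (prodf X Y) Z)) f) x =
   kcomp (kcomp (fstf Y Z) (sndf X (prodf Y Z))) x by apply: kmorP.
have -> : kcomp (kcomp (sndf (prodf X Y) Z) f) x =
   kcomp (kcomp (sndf Y Z) (sndf X (prodf Y Z))) x by apply: kmorP.
by tauto.
Qed.

Lemma gr_mul1 x : gr_eq (gr_mul gr_one x) x.
Proof.
elim: x => [a||x1 h1 x2 h2|x h] /=; [|exact: gr_refl|exact: gr_addE|
  exact: gr_oppE].
case: a => X A hA; apply: gr_iso.
pose u : kmor X (pointf k) := @KMor _ X (pointf k) (fun _ _ => tt)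
  (fun _ _ _ _ => erefl).
apply: (@sieve_iso_sch _ (kprod (kpoint k) X) X _ _ (sndf (pointf k) X) (pairf u (kid X))) => //=.
  by move=> R [[]].
by move=> z x; split=> [[]|].
Qed.

Lemma gr_ring :
  ring_theory (gr_zero) gr_one gr_add gr_mul gr_sub gr_opp gr_eq /\
  (forall x x' y y', gr_eq x x' -> gr_eq y y' ->
     gr_eq (gr_mul x y) (gr_mul x' y')).
Proof.
split; last exact: gr_mul_eq.
split; [exact: gr_add0|exact: gr_addC|exact: gr_addA|exact: gr_mul1|
  exact: gr_mulC|exact: gr_mulA| | |exact: gr_addN].
  by move=> x y z; apply: gr_refl.
by move=> x y; apply: gr_refl.
Qed.

Record gr_endomorphism (Phi : gr -> gr) : Prop := GrEndomorphism {
  gr_endo_eq : forall a b, gr_eq a b -> gr_eq (Phi a) (Phi b);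
  gr_endo_add : forall a b, gr_eq (Phi (gr_add a b)) (gr_add (Phi a) (Phi b));
  gr_endo_mul : forall a b, gr_eq (Phi (gr_mul a b)) (gr_mul (Phi a) (Phi b));
  gr_endo_one : gr_eq (Phi gr_one) gr_one }.

(* the assignment [A] |-> [T A] defines a ring endomorphism of Gr(M); in
   particular T preserves M *)
Definition induces_endomorphism
    (T : forall Y : kscheme k, sieve Y -> sieve Y) : Prop :=
  exists2 Phi : gr -> gr, gr_endomorphism Phi &
    forall (Y : kscheme k) (A : sieve Y) (hA : M _ A),
      exists hT : M _ (T Y A),
        gr_eq (Phi (gr_sym (Motif hA))) (gr_sym (Motif hT)).

End Grothendieck.

(* A sub-schemic adjunction between a functor z |-> F z on fat points, with
   action Fm on morphisms, and Y |-> N Y on k-schemes; the functor N acts on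
   morphisms by restriction. *)
Record sub_schemic_adjunction (k : fieldType) (Fo : fat k -> fat k)
    (Fm : forall z z', fatmor z z' -> fatmor (Fo z) (Fo z'))
    (N : forall Y : kscheme k, sieve Y)
    (theta : forall (Y : kscheme k) (z : fat k),
       pts Y (Fo z) -> {y : pts Y z | N Y z y}) : Prop := SubSchemicAdjunction {
  adj_id : forall z, Fm z z (kid _) = kid _;
  adj_comp : forall z1 z2 z3 (a : fatmor z1 z2) (b : fatmor z2 z3),
    Fm _ _ (kcomp b a) = kcomp (Fm _ _ b) (Fm _ _ a);
  adj_sub_schemic : forall Y, sub_schemic (N Y);
  adj_map : forall (Y Y' : kscheme k) (g : kmor Y Y') z (y : pts Y z),
    N Y z y -> N Y' z (kcomp g y);
  adj_bij : forall Y z, bijective (@theta Y z);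
  adj_nat_fat : forall Y z z' (a : fatmor z' z) (y : pts Y (Fo z)),
    sval (theta Y z' (kcomp y (Fm _ _ a))) = kcomp (sval (theta Y z y)) a;
  adj_nat_sch : forall (Y Y' : kscheme k) (g : kmor Y Y') z (y : pts Y (Fo z)),
    sval (theta Y' z (kcomp g y)) = kcomp g (sval (theta Y z y)) }.

Section Frobenius.
Variables (k : fieldType) (p : nat).
Hypothesis pchark : p \in [pchar k].
Hypothesis perfect : forall a : k, exists b : k, b ^+ p = a.

Section FrobAlg.
Variable R : comAlgType k.

Definition frob_pred : {pred R} := fun x => `[< exists y : R, x = y ^+ p >].

Lemma pchar_alg : p \in [pchar R].
Proof.
have := pchark; rewrite !inE => /andP[-> /eqP h] /=.
by rewrite -(scaler_nat (V:=R)) h scale0r.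
Qed.

Lemma frobD (x y : R) : (x + y) ^+ p = x ^+ p + y ^+ p.
Proof. exact: (rmorphD (pFrobenius_aut pchar_alg)). Qed.

Lemma frob_subalg : subalg_closed frob_pred.
Proof.
split.
- by apply/asboolP; exists 1; rewrite expr1n.
- move=> a u v /asboolP[x ->] /asboolP[y ->]; apply/asboolP.
  by have [b <-] := perfect a; exists (b *: x + y); rewrite frobD exprZn.
- move=> u v /asboolP[x ->] /asboolP[y ->]; apply/asboolP.
  by exists (x * y); rewrite exprMn.
Qed.

HB.instance Definition _ :=
  GRing.isSubalgClosed.Build k R frob_pred frob_subalg.

Record frob_alg := FrobAlg { frob_val : R; _ : frob_val \in frob_pred }.
HB.instance Definition _ := [isSub for frob_val].
HB.instance Definition _ := [Choice of frob_alg by <:].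
HB.instance Definition _ := [SubChoice_isSubComNzRing of frob_alg by <:].
HB.instance Definition _ := [SubZmodule_isSubLmodule of frob_alg by <:].
HB.instance Definition _ :=
  [SubNzRing_SubLmodule_isSubLalgebra of frob_alg by <:].
HB.instance Definition _ := [SubLalgebra_isSubAlgebra of frob_alg by <:].

Definition FR : comAlgType k := frob_alg.

Definition frob_fun (x : FR) : R := frob_val x.

Fact frob_fun_zmod : zmod_morphism frob_fun. Proof. by []. Qed.
Fact frob_fun_monoid : monoid_morphism frob_fun. Proof. by []. Qed.
Fact frob_fun_scal : scalable frob_fun. Proof. by []. Qed.

HB.instance Definition _ :=
  GRing.isZmodMorphism.Build FR R frob_fun frob_fun_zmod.
HB.instance Definition _ :=
  GRing.isMonoidMorphism.Build FR R frob_fun frob_fun_monoid.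
HB.instance Definition _ :=
  GRing.isScalable.Build k FR R *:%R frob_fun frob_fun_scal.

Definition frob_incl : {lrmorphism FR -> R} := frob_fun.

Lemma frob_inclP (x : FR) : exists y : R, frob_incl x = y ^+ p.
Proof. by case: x => x /= /asboolP. Qed.

Lemma frob_incl_inj : injective frob_incl.
Proof. exact: val_inj. Qed.

Definition frob_elt (y : R) : FR.
Proof. by exists (y ^+ p); apply/asboolP; exists y. Defined.

Lemma frob_incl_elt y : frob_incl (frob_elt y) = y ^+ p.
Proof. by []. Qed.

Lemma frob_eltP (x : FR) : exists y, x = frob_elt y.
Proof. by have [y e] := frob_inclP x; exists y; apply: frob_incl_inj. Qed.

Lemma FR_finite : finite_over_k R -> finite_over_k FR.
Proof.
case=> s hs; exists (map frob_elt s) => x.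
have [y ->] := frob_eltP x; have [c ->] := hs y.
exists (map (fun a => a ^+ p) c); apply: frob_incl_inj.
rewrite frob_incl_elt -(pFrobenius_autE pchar_alg) !rmorph_sum size_map /=.
apply: eq_bigr => i _; rewrite pFrobenius_autE exprZn.
rewrite (nth_map 0 0 frob_elt) //=; congr (_ *: _).
have [ltic|leci] := ltnP i (size c); first by rewrite (nth_map 0).
rewrite !nth_default ?size_map // expr0n.
by case/pcharf_prime: pchark => /prime_gt0; case: (p).
Qed.

Lemma prime_ideal_exp (P : R -> Prop) x n :
  prime_ideal P -> P (x ^+ n) -> P x.
Proof.
move=> [_ P1 PM]; elim: n => [|n IH]; first by rewrite expr0.
by rewrite exprS => /PM[].
Qed.

Lemma FR_local : unique_prime R -> unique_prime FR.
Proof.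
have pgt0 : (0 < p)%N by exact/prime_gt0/pcharf_prime/pchark.
case=> -[P primeP] uR; split.
  have [[P0 PD PM] P1 Pp] := primeP; exists (fun x => P (frob_incl x)); split.
  - split=> [|x y hx hy|a x hx]; first by rewrite rmorph0.
      by rewrite rmorphD; apply: PD.
    by rewrite rmorphM; apply: PM.
  - by rewrite rmorph1.
  - by move=> x y; rewrite rmorphM => /Pp.
have lift (Q : FR -> Prop) : prime_ideal Q ->
    prime_ideal (fun y => Q (frob_elt y)).
  move=> [[Q0 QD QM] Q1 Qp]; split.
  - split.
    + suff -> : frob_elt 0 = 0 by [].
      by apply: frob_incl_inj; rewrite frob_incl_elt expr0n gtn_eqF.
    + move=> x y hx hy; suff -> : frob_elt (x + y) = frob_elt x + frob_elt y.
        exact: QD.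
      by apply: frob_incl_inj; rewrite rmorphD !frob_incl_elt frobD.
    + move=> a x hx; suff -> : frob_elt (a * x) = frob_elt a * frob_elt x.
        exact: QM.
      by apply: frob_incl_inj; rewrite rmorphM !frob_incl_elt exprMn.
  - suff <- : 1 = frob_elt 1 by [].
    by apply: frob_incl_inj; rewrite frob_incl_elt expr1n rmorph1.
  - move=> x y; suff -> : frob_elt (x * y) = frob_elt x * frob_elt y.
      exact: Qp.
    by apply: frob_incl_inj; rewrite rmorphM !frob_incl_elt exprMn.
move=> Q Q' /lift hQ /lift hQ' x; have [y ->] := frob_eltP x.
exact: (uR _ _ hQ hQ').
Qed.

End FrobAlg.

Section FrobMap.
Variables (R S : comAlgType k) (phi : {lrmorphism R -> S}).

Definition frob_map_fun (x : FR R) : FR S.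
Proof.
exists (phi (frob_incl R x)); apply/asboolP.
by have [y ->] := frob_inclP x; exists (phi y); rewrite rmorphXn.
Defined.

Lemma frob_map_funE x : frob_incl S (frob_map_fun x) = phi (frob_incl R x).
Proof. by []. Qed.

Fact frob_map_zmod : zmod_morphism frob_map_fun.
Proof.
by move=> x y; apply: frob_incl_inj; rewrite !(rmorphB, frob_map_funE).
Qed.

Fact frob_map_monoid : monoid_morphism frob_map_fun.
Proof.
split=> [|x y]; apply: frob_incl_inj; first by rewrite frob_map_funE !rmorph1.
by rewrite !(rmorphM, frob_map_funE).
Qed.

Fact frob_map_scal : scalable frob_map_fun.
Proof.
by move=> a x; apply: frob_incl_inj; rewrite !(linearZ, frob_map_funE).
Qed.

HB.instance Definition _ :=
  GRing.isZmodMorphism.Build (FR R) (FR S) frob_map_fun frob_map_zmod.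
HB.instance Definition _ :=
  GRing.isMonoidMorphism.Build (FR R) (FR S) frob_map_fun frob_map_monoid.
HB.instance Definition _ :=
  GRing.isScalable.Build k (FR R) (FR S) *:%R frob_map_fun frob_map_scal.

Definition frob_map : {lrmorphism FR R -> FR S} := frob_map_fun.

End FrobMap.

Definition frob_fat (z : fat k) : fat k :=
  Fat (FR_finite (@fat_finite k z)) (FR_local (@fat_local k z)).

Definition frob_fatmor (z z' : fat k) (a : fatmor z z') :
    fatmor (frob_fat z) (frob_fat z') :=
  Spec_map (frob_map (Spec_hom a)).

Definition frob_unit (z : fat k) : fatmor z (frob_fat z) :=
  Spec_map (frob_incl z).

(* the inclusion of Y(Fz) in Y(z) *)
Definition frob_pts (Y : kscheme k) (z : fat k) (y : pts Y (frob_fat z)) :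
    pts Y z := kcomp y (frob_unit z).

Lemma frob_unit_nat (z z' : fat k) (a : fatmor z z') :
  kcomp (frob_unit z') a = kcomp (frob_fatmor a) (frob_unit z).
Proof.
apply: kmorP => R x; apply: lrmorphP => t /=.
have -> : x = fmap (Spec z) x idfun by apply: lrmorphP.
by rewrite app_nat.
Qed.

Definition nabla (Y : kscheme k) (A : sieve Y) : sieve Y.
Proof.
exists (fun z x => exists2 y : pts Y (frob_fat z), A _ y & frob_pts y = x).
move=> z z' a _ [y hy <-]; exists (kcomp y (frob_fatmor a)).
  exact: smem_comp.
by rewrite /frob_pts -!kcompA frob_unit_nat.
Defined.

Definition frob_eqs n (fs : seq {mpoly k[n]}) : seq {mpoly k[n]} :=
  [seq f \mPo [tuple 'X_i ^+ p | i < n] | f <- fs].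

Lemma frob_eqs_zeros n (fs : seq {mpoly k[n]}) (R : comAlgType k)
    (a : 'I_n -> R) :
  zeros (frob_eqs fs) a -> zeros fs (fun i => a i ^+ p).
Proof.
move=> h f hf; rewrite -(h _ (map_f _ hf)) mev_comp; apply: mev_eq => i.
by rewrite tnth_mktuple /mev rmorphXn /= -/(mev a _) mevX.
Qed.

(* Spec k[x]/(fs(x^p)) -> Spec k[x]/(fs), induced by x |-> x^p *)
Definition power_mor n (fs : seq {mpoly k[n]}) :
  kmor (closed_sub (frob_eqs fs)) (closed_sub fs).
Proof.
exists (fun R (u : closed_sub (frob_eqs fs) R) =>
  exist _ (fun i => sval u i ^+ p) (frob_eqs_zeros (svalP u))).
by move=> R S phi u; apply: zerosP => i /=; rewrite rmorphXn.
Defined.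

(* The Frobenius motif of Y, glued along a covering C by open affines. *)
Definition frob_motif (Y : kscheme k) (C : chart Y -> Prop) : sieve Y.
Proof.
exists (fun z x => exists2 c, C c &
  exists y : kmor (Spec z) (closed_sub (frob_eqs (chart_eqs c))),
    kcomp (chart_map c) (kcomp (power_mor (chart_eqs c)) y) = x).
move=> z z' a _ [c hc [y <-]]; exists c => //; exists (kcomp y a).
by rewrite !kcompA.
Defined.

End Frobenius.

(* Main.v *)
(* A fat point is local, so a morphism from it to Y factors through any chart
   that contains the image of the closed point.  On a chart {f = 0}, a point with
   values in FR is a tuple b^p with f(b^p) = 0, that is, the image of a point of
   Spec k[x]/(f(x^p)) with values in R.  Hence F_Y(z) is the image of the
   injection Y(Fz) -> Y(z), whatever the covering used to define F_Y.  Taking a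
   finite one, F_Y is the image of a disjoint union of affine schemes
   Spec k[x]/(f(x^p)), so it is sub-schemic; and nabla sends Im(phi : X -> Y) to
   the image under phi of F_X, so it preserves sub-schemic motives, hence formal
   ones.  It commutes with unions, intersections, products and isomorphisms
   because A |-> A(Fz) does. *)

From HB Require Import structures.
Require Import Defs.
From mathcomp Require Import all_boot all_order all_algebra.
From mathcomp Require Import boolp classical_sets mpoly ring_quotient ring.

Set Implicit Arguments.
Unset Strict Implicit.
Unset Printing Implicit Defensive.

Import GRing.Theory.
Local Open Scope ring_scope.

(** * Quotients of commutative algebras by proper ideals *)

Section QuotientAlgebra.
Variables (k : fieldType) (A : comNzRingType) (iota : {rmorphism k -> A}).
Variable J : A -> Prop.
Hypothesis J0 : J 0.
Hypothesis JD : forall x y, J x -> J y -> J (x + y).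
Hypothesis JM : forall a x, J x -> J (a * x).
Hypothesis J1 : ~ J 1.

Let ideal_pred : {pred A} := fun x => `[< J x >].

Fact ideal_pred_closed : idealr_closed ideal_pred.
Proof.
split; [exact/asboolP|exact/asboolPn|move=> a x y /asboolP hx /asboolP hy].
by apply/asboolP; apply: JD => //; apply: JM.
Qed.

HB.instance Definition _ := isIdealr.Build A ideal_pred ideal_pred_closed.

Let quot_alg : Type := {ideal_quot ideal_pred}.
HB.instance Definition _ := GRing.ComNzRing.on quot_alg.

Let proj : {rmorphism A -> quot_alg} := \pi_{ideal_quot ideal_pred}%qT.

Let quot_scale (c : k) (x : quot_alg) : quot_alg := proj (iota c) * x.

Fact quot_scaleA a b v : quot_scale a (quot_scale b v) = quot_scale (a * b) v.
Proof. by rewrite /quot_scale mulrA !rmorphM. Qed.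
Fact quot_scale1 : left_id 1 quot_scale.
Proof. by move=> x; rewrite /quot_scale !rmorph1 mul1r. Qed.
Fact quot_scaleDr : right_distributive quot_scale +%R.
Proof. by move=> c x y; rewrite /quot_scale mulrDr. Qed.
Fact quot_scaleDl v : {morph quot_scale^~ v : a b / a + b}.
Proof. by move=> a b; rewrite /quot_scale !rmorphD mulrDl. Qed.

HB.instance Definition _ := GRing.Zmodule_isLmodule.Build k quot_alg
  quot_scaleA quot_scale1 quot_scaleDr quot_scaleDl.

Fact quot_scaleAl (c : k) (x y : quot_alg) : c *: (x * y) = c *: x * y.
Proof. exact: mulrA. Qed.

HB.instance Definition _ :=
  GRing.Lmodule_isLalgebra.Build k quot_alg quot_scaleAl.
HB.instance Definition _ := GRing.Lalgebra_isComAlgebra.Build k quot_alg.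

(** Scalars act through [iota], so that the construction serves both for [R] modulo a prime and for
    [{poly R}] modulo a principal ideal. *)
Lemma quotient_alg : exists (Q : comAlgType k) (pi : {rmorphism A -> Q}),
  [/\ forall x, exists a, pi a = x,
      forall a, pi a = 0 <-> J a
    & forall c, pi (iota c) = c%:A].
Proof.
exists quot_alg, proj; split.
- by move=> x; exists (repr x); apply: reprK.
- move=> a; rewrite -(rmorph0 proj); split=> [/eqP|h].
    by rewrite -Quotient.idealrBE subr0 => /asboolP.
  by apply/eqP; rewrite -Quotient.idealrBE subr0; apply/asboolP.
- by move=> c; rewrite -[LHS]mulr1.
Qed.

End QuotientAlgebra.

(** * Existence of primes, residue fields and localizations *)

Section Algebras.
Variable k : fieldType.
Implicit Types (R S T : comAlgType k).

Lemma lrmorphism_of R S (g : R -> S) :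
  zmod_morphism g -> monoid_morphism g -> scalable g ->
  exists f : {lrmorphism R -> S}, f =1 g.
Proof.
move=> ga gm gs.
pose a := GRing.isZmodMorphism.Build R S g ga.
pose m := GRing.isMonoidMorphism.Build R S g gm.
pose s := GRing.isScalable.Build k R S *:%R g gs.
pose f : {lrmorphism R -> S} := HB.pack g a m s.
by exists f.
Qed.

(** Zorn's lemma on the sets [A], closed under sums and multiples, for which [A + Rx] misses 1. A
    maximal one absorbs [x] and is then a maximal ideal, hence prime. *)
Lemma prime_ideal_nonunit R (x : R) : (forall y, x * y <> 1) ->
  exists2 P, prime_ideal P & P x.
Proof.
move=> xN1.
pose proper (A : set R) := [/\ forall a b, A a -> A b -> A (a + b),
  forall c a, A a -> A (c * a) & forall a c, A a -> a + c * x <> 1].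
(* [proper] does not require 0 in A, so that it holds for the union of the
   empty chain *)
have [F Fp totF|A [[AD AM A1] Amax]] := @Zorn_bigcup R proper.
  split.
  - move=> a b [B FB Ba] [D FD Db].
    have [BD|DB] := totF _ _ FB FD.
      by exists D => //; have [+ _ _] := Fp _ FD; apply=> //; apply: BD.
    by exists B => //; have [+ _ _] := Fp _ FB; apply=> //; apply: DB.
  - by move=> c a [B FB Ba]; exists B => //; have [_ + _] := Fp _ FB; apply.
  - by move=> a c [B FB Ba]; have [_ _ +] := Fp _ FB; apply.
(* If [A] were empty, the multiples of [x] would form a strictly larger [proper] set. *)
have A0 : A 0.
  have [[a Aa]|nA] := pselect (exists a, A a); first by rewrite -(mul0r a); apply: AM.
  case: (Amax [set b | exists c, b = c * x]%classic); last first.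
    split.
    - by move=> _ _ [c ->] [d ->]; exists (c + d); rewrite mulrDl.
    - by move=> c _ [d ->]; exists (c * d); rewrite mulrA.
    - by move=> _ d [c ->]; rewrite -mulrDl mulrC; apply: xN1.
  split; first by move=> a Aa; case: nA; exists a.
  by move=> h; case: nA; exists 0; apply: h; exists 0; rewrite mul0r.
(* By maximality, enlarging [A] by the multiples of [a] destroys [proper], so 1 lies in
   [A + Ra + Rx]. *)
have ext a : ~ A a -> exists m c d, A m /\ m + c * a + d * x = 1.
  move=> nAa; apply: contrapT => nex.
  case: (Amax [set b | exists m c, A m /\ b = m + c * a]%classic).
    split; first by move=> m Am; exists m, 0; rewrite mul0r addr0.
    by move=> h; apply: nAa; apply: h; exists 0, 1; rewrite add0r mul1r.
  split.
  - move=> _ _ [m [c [Am ->]]] [n [d [An ->]]].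
    by exists (m + n), (c + d); split; [apply: AD|rewrite mulrDl addrACA].
  - move=> d _ [m [c [Am ->]]].
    by exists (d * m), (d * c); split; [apply: AM|rewrite mulrDr mulrA].
  - by move=> _ d [m [c [Am ->]]] e; apply: nex; exists m, c, d.
have Ax : A x.
  apply: contrapT => /ext[m [c [d [Am]]]].
  by rewrite -addrA -mulrDl; apply: A1.
have {}ext a : ~ A a -> exists m c, A m /\ m + c * a = 1.
  move=> /ext[m [c [d [Am e]]]]; exists (m + d * x), c; split.
    by apply: AD => //; apply: AM.
  by rewrite addrAC.
exists A => //; split=> [//|A_1|a b Aab].
  by apply: (A1 _ 0 A_1); rewrite mul0r addr0.
apply: contrapT => /not_orP[/ext[m [c [Am em]]] /ext[n [d [An en]]]].
suff A_1 : A 1 by apply: (A1 _ 0 A_1); rewrite mul0r addr0.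
(* All terms of (m + ca)(n + db) = 1 lie in [A], because ab does. *)
rewrite -(mulr1 1) -{1}em -en mulrDl; apply: (AD).
  by rewrite mulrC; apply: (AM).
rewrite mulrDr; apply: (AD); first exact: AM.
by rewrite mulrACA; apply: AM.
Qed.

Lemma unique_prime_unit R (P : R -> Prop) (x : R) :
  unique_prime R -> prime_ideal P -> ~ P x -> exists y, x * y = 1.
Proof.
move=> [_ uP] hP nPx; apply: contrapT => nu.
have [y e|Q hQ Qx] := @prime_ideal_nonunit R x; first by apply: nu; exists y.
by apply: nPx; apply/(uP _ _ hP hQ).
Qed.

Lemma residue_field R (P : R -> Prop) : unique_prime R -> prime_ideal P ->
  exists (K : comAlgType k) (pi : {lrmorphism R -> K}),
    is_field K /\ forall r, pi r = 0 <-> P r.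
Proof.
move=> uR hP; have [[P0 PD PM] P1 _] := hP.
have [K [pi [piS pi0 pik]]] := quotient_alg (GRing.in_alg R) P0 PD PM P1.
have [||c x|f fE] := @lrmorphism_of R K pi.
- exact: rmorphB.
- by split; [apply: rmorph1|apply: rmorphM].
- by rewrite -mulr_algl rmorphM /= pik mulr_algl.
exists K, f; split=> [x x0|r]; last by rewrite fE.
have [a xE] := piS x.
have [/pi0 a0|b ab] := unique_prime_unit uR hP (x := a).
  by rewrite -xE a0 eqxx in x0.
by exists (pi b); rewrite -xE -rmorphM ab rmorph1.
Qed.

(** [T] is R[X]/(fX - 1), nonzero because [f] is not nilpotent. *)
Lemma localization_exists R (f : R) : (forall n, f ^+ n <> 0) ->
  exists (T : comAlgType k) (l : {lrmorphism R -> T}),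
    (exists s, l f * s = 1) /\ forall r, l r = 0 -> exists n, f ^+ n * r = 0.
Proof.
move=> fn0; pose g : {poly R} := f%:P * 'X - 1.
pose J (q : {poly R}) := exists h, q = h * g.
have tors r h : r%:P = h * g -> exists n, f ^+ n * r = 0.
  (* Comparing coefficients in r = h(fX - 1) gives h_0 = -r and h_(n+1) = f h_n; the coefficient of
     index [size h] is 0. *)
  move=> e; have hE n : h`_n = - (f ^+ n * r).
    elim: n => [|n IH].
      have := congr1 (fun q : {poly R} => q`_0) e.
      rewrite /g mulrBr mulr1 mulrA coefB coefMX coefC /= sub0r => ->.
      by rewrite expr0 mul1r opprK.
    have := congr1 (fun q : {poly R} => q`_n.+1) e.
    rewrite /g mulrBr mulr1 mulrA coefB coefMX coefC /= coefMC IH => /eqP.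
    by rewrite eq_sym subr_eq0 => /eqP <-; rewrite mulNr exprSr mulrAC.
  exists (size h); apply/eqP; rewrite -oppr_eq0 -hE; apply/eqP.
  by rewrite nth_default.
pose iota : {rmorphism k -> {poly R}} := polyC \o GRing.in_alg R.
have [||||T [pi [_ pi0 pik]]] := @quotient_alg k {poly R} iota J.
- by exists 0; rewrite mul0r.
- by move=> _ _ [h ->] [h' ->]; exists (h + h'); rewrite mulrDl.
- by move=> a _ [h ->]; exists (a * h); rewrite mulrA.
- by move=> [h e]; have [n] := tors 1 h e; rewrite mulr1; apply: fn0.
have [||c x|l lE] := @lrmorphism_of R T (pi \o polyC).
- exact: rmorphB.
- by split; [apply: rmorph1|apply: rmorphM].
- by rewrite /= -mulr_algl polyCM rmorphM /= (pik c) mulr_algl.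
exists T, l; split.
  exists (pi 'X); rewrite lE /= -rmorphM; apply/eqP.
  rewrite -subr_eq0 -(rmorph1 pi) -rmorphB; apply/eqP/pi0.
  by exists 1; rewrite mul1r.
by move=> r; rewrite lE => /pi0[h]; apply: tors.
Qed.

End Algebras.

(** * Universal property of localizations and gluing of functions *)

Section Localization.
Variable k : fieldType.
Implicit Types (R S T : comAlgType k).

Lemma localization_lift R S T (f : R) (l : {lrmorphism R -> S})
    (h : {lrmorphism R -> T}) : is_localization f l ->
  (exists t, h f * t = 1) -> exists g : {lrmorphism S -> T}, g \o l =1 h.
Proof.
move=> [_ frac tors] [t ht].
have htn n : h f ^+ n * t ^+ n = 1 by rewrite -exprMn ht expr1n.
have cancel n (a b : T) : a * h f ^+ n = b * h f ^+ n -> a = b.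
  move=> e; rewrite -(mulr1 a) -(mulr1 b) -(htn n) !mulrA.
  by congr (_ * _).
have eqh r r' : l r = l r' -> h r = h r'.
  move=> e; have [n e0] : exists n, f ^+ n * (r - r') = 0.
    by apply: tors; rewrite rmorphB /= e subrr.
  apply: (cancel n); apply/eqP; rewrite -subr_eq0 -mulrBl mulrC.
  by rewrite -rmorphXn -rmorphB -rmorphM e0 rmorph0.
(* [v] has to fit every fraction representing [s], so each later identity can be checked on any
   convenient representation. *)
have /choice[g gE] : forall s, exists v, forall r n,
    s * l f ^+ n = l r -> v * h f ^+ n = h r.
  move=> s; have [r [n e]] := frac s; exists (h r * t ^+ n) => r' n' e'.
  have e2 : l (r * f ^+ n') = l (r' * f ^+ n).
    by rewrite !rmorphM !rmorphXn /= -e -e' mulrAC.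
  have := eqh _ _ e2; rewrite !rmorphM !rmorphXn => e3.
  by rewrite mulrAC e3 -mulrA htn mulr1.
have gl r : g (l r) = h r.
  by have := gE (l r) r 0; rewrite !expr0 !mulr1; apply.
have [s s'|||G GE] := @lrmorphism_of _ S T g.
- have [r [n e]] := frac s; have [r' [n' e']] := frac s'.
  have := gE (s - s') (r * f ^+ n' - r' * f ^+ n) (n + n')%N.
  rewrite !rmorphB !rmorphM !rmorphXn /= -e -e' exprD mulrBl.
  rewrite mulrA (mulrC (l f ^+ n)) mulrA => /(_ erefl) e1.
  apply: (cancel (n + n')%N); rewrite e1 exprD -(gE _ _ _ e) -(gE _ _ _ e').
  by rewrite mulrBl mulrA (mulrC (h f ^+ n)) mulrA.
- split=> [|s s']; first by rewrite -(rmorph1 l) gl rmorph1.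
  have [r [n e]] := frac s; have [r' [n' e']] := frac s'.
  apply: (cancel (n + n')%N); rewrite exprD mulrACA.
  rewrite (gE _ _ _ e) (gE _ _ _ e') -rmorphM -exprD; apply: gE.
  by rewrite exprD mulrACA e e' -rmorphM.
- move=> c s; have [r [n e]] := frac s.
  apply: (cancel n); rewrite -scalerAl (gE _ _ _ e) -linearZ; apply: gE.
  by rewrite -scalerAl e -linearZ.
by exists G => r; rewrite /= GE gl.
Qed.

(** The radical of [J] is an ideal, and it contains [A]. *)
Lemma generates_unit_radical R (A J : R -> Prop) :
  generates_unit A -> is_ideal J -> (forall a, A a -> exists n, J (a ^+ n)) ->
  J 1.
Proof.
move=> uA [J0 JD JM] hA.
suff [n] : exists n, J (1 ^+ n) by rewrite expr1n.
apply: (uA (fun a => exists n, J (a ^+ n))) => //; split.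
- by exists 1%N; rewrite expr1.
(* In each binomial term either [x] has exponent at least [n] or [y] has exponent at least [m]. *)
- move=> x y [n hx] [m hy]; exists (n + m)%N; rewrite exprDn.
  elim/big_ind: _ => // i _; rewrite -mulr_natl; apply: (JM).
  have [mi|im] := leqP m i.
    by rewrite -(subnK mi) exprD mulrA; apply: JM.
  rewrite mulrC; have ni : (n <= n + m - i)%N.
    by rewrite -addnBA ?leq_addr // ltnW.
  by rewrite -(subnK ni) exprD mulrA; apply: JM.
- by move=> a x [n hx]; exists n; rewrite exprMn; apply: JM.
Qed.

Lemma generates_unit_image R S (phi : {lrmorphism R -> S}) m (f : 'I_m -> R) :
  generates_unit (fun r => exists i, f i = r) ->
  generates_unit (fun s => exists i, phi (f i) = s).
Proof.
move=> uf J [J0 JD JM] hJ; rewrite -(rmorph1 phi).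
apply: (uf (fun r => J (phi r))) => [|_ [i <-]]; last by apply: hJ; exists i.
split; first by rewrite rmorph0.
  by move=> x y; rewrite rmorphD; apply: JD.
by move=> a x; rewrite rmorphM; apply: JM.
Qed.

(** The annihilator of [r] is an ideal containing a power of each [f i], hence 1. *)
Lemma eq0_local R m (f : 'I_m -> R) (r : R) :
  generates_unit (fun r => exists i, f i = r) ->
  (forall i, exists n, f i ^+ n * r = 0) -> r = 0.
Proof.
move=> uf h; rewrite -(mul1r r).
apply: (generates_unit_radical (J := fun a => a * r = 0) uf).
  split=> [|x y ex ey|a x ex]; first by rewrite mul0r.
    by rewrite mulrDl ex ey addr0.
  by rewrite -mulrA ex mulr0.
by move=> _ [i <-].
Qed.

Section AffineLine.
Variables (R : comAlgType k) (m : nat) (f : 'I_m -> R).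
Variables (S : 'I_m -> comAlgType k) (l : forall i, {lrmorphism R -> S i}).
Hypothesis unit_f : generates_unit (fun r => exists i, f i = r).
Hypothesis loc_l : forall i, is_localization (f i) (l i).

Lemma affine_line_separated (r r' : R) : (forall i, l i r = l i r') -> r = r'.
Proof.
move=> h; apply/eqP; rewrite -subr_eq0; apply/eqP/(eq0_local unit_f) => i.
by have [_ _] := loc_l i; apply; rewrite rmorphB /= h subrr.
Qed.

Lemma unit_span_pow N : exists a : 'I_m -> R, \sum_i a i * f i ^+ N = 1.
Proof.
pose J b := exists a : 'I_m -> R, \sum_i a i * f i ^+ N = b.
apply: (@generates_unit_radical _ _ J unit_f); first split.
- by exists (fun=> 0); rewrite big1 // => i _; rewrite mul0r.
- move=> _ _ [a <-] [b <-]; exists (fun i => a i + b i).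
  by rewrite -big_split; apply: eq_bigr => i _; rewrite mulrDl.
- move=> c _ [a <-]; exists (fun i => c * a i).
  by rewrite mulr_sumr; apply: eq_bigr => i _; rewrite mulrA.
move=> _ [i <-]; exists N, (fun j => (j == i)%:R).
rewrite (bigD1 i) //= eqxx mul1r big1 ?addr0 // => j /negPf->.
by rewrite mul0r.
Qed.

(** Existence half of the sheaf condition for the affine line: the local functions get a common
    denominator exponent and are averaged by a partition of unity. *)
Lemma affine_line_glue (x : forall i, S i) :
  (forall i j T (u : {lrmorphism S i -> T}) (v : {lrmorphism S j -> T}),
     u \o l i =1 v \o l j -> u (x i) = v (x j)) ->
  exists y, forall i, l i y = x i.
Proof.
move=> compat.
have [N0 [r0 r0E]] : exists (n : 'I_m -> nat) (r : 'I_m -> R),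
    forall i, x i * l i (f i) ^+ n i = l i (r i).
  have /choice[q qE] : forall i, exists q : R * nat,
      x i * l i (f i) ^+ q.2 = l i q.1.
    by move=> i; have [_ /(_ (x i)) [r [n e]] _] := loc_l i; exists (r, n).
  by exists (fun i => (q i).2), (fun i => (q i).1).
pose N := (\sum_i N0 i)%N; pose r i := r0 i * f i ^+ (N - N0 i).
have rE i : x i * l i (f i) ^+ N = l i (r i).
  have le : (N0 i <= N)%N by rewrite /N (bigD1 i) //= leq_addr.
  by rewrite rmorphM /= -r0E -mulrA rmorphXn -exprD subnKC.
clearbody r.
have cross i j : exists n,
    (f i * f j) ^+ n * (f j ^+ N * r i - f i ^+ N * r j) = 0.
  (* [x i] and [x j] are compared in [R] localized at [f i * f j]. If this product is nilpotent,
     that localization is zero and not a test algebra, but then some power kills the difference. *)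
  have [[n e]|nn] := pselect (exists n, (f i * f j) ^+ n = 0).
    by exists n; rewrite e mul0r.
  have [n e|T [psi [[s hs] tors]]] := @localization_exists _ _ (f i * f j).
    by apply: nn; exists n.
  have [|u uE] := localization_lift (h := psi) (loc_l i).
    by exists (psi (f j) * s); rewrite mulrA -rmorphM.
  have [|v vE] := localization_lift (h := psi) (loc_l j).
    by exists (psi (f i) * s); rewrite mulrA -rmorphM (mulrC (f j)).
  have e : u (x i) = v (x j) by apply: compat => a; rewrite uE vE.
  have := congr1 u (rE i); have := congr1 v (rE j).
  rewrite !rmorphM !rmorphXn /= -![u (l _ _)]/((u \o _) _).
  rewrite -![v (l _ _)]/((v \o _) _) !uE !vE => ej ei.
  apply: tors; apply/eqP; rewrite rmorphB !rmorphM !rmorphXn /= subr_eq0 -ei -ej.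
  by rewrite e mulrCA [in X in _ == X]mulrCA (mulrC (psi (f j) ^+ N)).
have /choice[M0 M0E] := fun ij : 'I_m * 'I_m => cross ij.1 ij.2.
pose M := (\sum_ij M0 ij)%N.
have ME i j : f j ^+ (N + M) * (r i * f i ^+ M) =
    f i ^+ (N + M) * (r j * f j ^+ M).
  have le : (M0 (i, j) <= M)%N by rewrite /M (bigD1 (i, j)) //= leq_addr.
  have : (f i * f j) ^+ M * (f j ^+ N * r i - f i ^+ N * r j) = 0.
    by rewrite -(subnK le) exprD -mulrA (M0E (i, j)) mulr0.
  rewrite mulrBr => /eqP; rewrite subr_eq0 exprMn !exprD => /eqP e.
  have -> : f j ^+ N * f j ^+ M * (r i * f i ^+ M) =
    f i ^+ M * f j ^+ M * (f j ^+ N * r i) by ring.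
  by rewrite e; ring.
have [a aE] := unit_span_pow (N + M)%N.
(* By [ME] and [aE] this sum y satisfies f_j^(N+M) y = r_j f_j^M, so it becomes r_j / f_j^N, that is
   [x j], in [S j]. *)
exists (\sum_i a i * (r i * f i ^+ M)) => j.
have [[s hs] _ _] := loc_l j.
have e : f j ^+ (N + M) * (\sum_i a i * (r i * f i ^+ M)) = r j * f j ^+ M.
  rewrite mulr_sumr -[RHS]mul1r -aE mulr_suml; apply: eq_bigr => i _.
  by rewrite mulrCA ME -[RHS]mulrA.
have := congr1 (l j) e.
rewrite !rmorphM !rmorphXn /= -rE => e'.
rewrite -[LHS]mul1r -[RHS]mulr1 -(expr1n _ (N + M)) -hs !exprMn.
by rewrite mulrAC e' !exprD; ring.
Qed.

End AffineLine.

End Localization.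

(** * Points of a functor as morphisms from affine schemes *)

Section Yoneda.
Variable k : fieldType.
Implicit Types (R S : comAlgType k) (X : kfunctor k).

Definition point_mor X R (x : X R) : kmor (Spec R) X.
Proof.
exists (fun S (h : Spec R S) => fmap X h x).
by move=> S T f h; apply: (fmap_comp h f x).
Defined.

Lemma point_morE X R (x : X R) : point_mor x R idfun = x.
Proof. exact: fmap_id. Qed.

Lemma yoneda X R (u v : kmor (Spec R) X) : u R idfun = v R idfun -> u = v.
Proof.
move=> e; apply: kmorP => S h.
have -> : h = fmap (Spec R) h idfun by apply: lrmorphP.
by rewrite !app_nat e.
Qed.

End Yoneda.

(** * Disjoint unions of affine schemes over [Y] *)

Section Coproduct.
Variables (k : fieldType) (Y : kscheme k) (I : finType) (n : I -> nat).
Variables (fs : forall i, seq {mpoly k[n i]}).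
Variable g : forall i, kmor (closed_sub (fs i)) Y.
Implicit Types R S T : comAlgType k.

(* An R-point of the disjoint union of the affine schemes closed_sub (fs i):
   complete orthogonal idempotents e, a point b i of the i-th scheme over
   R[1/(e i)] (written as a vector over R supported on e i), and the common
   image y in Y(R).  Recording y makes the map to Y a projection, so that no
   gluing is needed to define it. *)
Record coprod_pt R := CoprodPt {
  cp_y : Y R;
  cp_e : I -> R;
  cp_b : forall i, 'I_(n i) -> R;
  cp_sum : \sum_i cp_e i = 1;
  cp_orth : forall i j, i != j -> cp_e i * cp_e j = 0;
  cp_supp : forall i (l : 'I_(n i)), cp_e i * cp_b l = cp_b l;
  cp_im : forall i S (phi : {lrmorphism R -> S}), phi (cp_e i) = 1 ->
    exists t : closed_sub (fs i) S,
      sval t =1 (fun l => phi (cp_b l)) /\ g i S t = fmap Y phi cp_y }.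
Arguments cp_b [R] _ i l.

Lemma coprod_ptP R (x x' : coprod_pt R) : cp_y x = cp_y x' ->
  cp_e x =1 cp_e x' -> (forall i, cp_b x i =1 cp_b x' i) -> x = x'.
Proof.
case: x x' => [y e b h1 h2 h3 h4] [y' e' b' h1' h2' h3' h4'] /= ey ee eb.
have {}ee : e = e' by apply: funext.
have {}eb : b = b'.
  by apply: functional_extensionality_dep => i; apply: funext; apply: eb.
subst y' e' b'; by rewrite (Prop_irrelevance h1 h1') (Prop_irrelevance h2 h2')
  (Prop_irrelevance h3 h3') (Prop_irrelevance h4 h4').
Qed.

Definition coprod_map R S (phi : {lrmorphism R -> S}) (x : coprod_pt R) :
  coprod_pt S.
Proof.
exists (fmap Y phi (cp_y x)) (fun i => phi (cp_e x i))
  (fun i l => phi (cp_b x i l)).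
- by rewrite -rmorph_sum cp_sum rmorph1.
- by move=> i j ij; rewrite -rmorphM cp_orth // rmorph0.
- by move=> i l; rewrite -rmorphM cp_supp.
- move=> i T psi e; rewrite -fmap_comp; exact: (@cp_im _ x i T (psi \o phi)).
Defined.

Definition coprod : kfunctor k.
Proof.
exists coprod_pt coprod_map.
- by move=> R x; apply: coprod_ptP => //=; rewrite fmap_id.
- by move=> R S T f h x; apply: coprod_ptP => //=; rewrite fmap_comp.
Defined.

Definition coprod_proj : kmor coprod Y.
Proof. by exists cp_y. Defined.

Definition coprod_incl i : kmor (closed_sub (fs i)) coprod.
Proof.
unshelve eexists.
  move=> R t; exists (g i R t) (fun j => (j == i)%:R)
    (dfwith (fun j (_ : 'I_(n j)) => 0) (sval t)).
  - rewrite (bigD1 i) //= eqxx big1 ?addr0 // => j /negPf-> //.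
  - move=> j j' jj'; have [ji|_] := eqVneq j i; last by rewrite mul0r.
    by rewrite eq_sym -ji (negPf jj') mulr0.
  - move=> j; have [<-|ij] := eqVneq i j => l; first by rewrite mul1r.
    by rewrite dfwith_out // mulr0.
  (* For j other than i the premise reads 0 = 1, impossible in the nonzero algebra [S]. *)
  - move=> j S phi; have [->|ji] := eqVneq j i; last first.
      by rewrite rmorph0 => /esym/eqP; rewrite oner_eq0.
    move=> _; exists (fmap (closed_sub (fs i)) phi t); split.
      by move=> l; rewrite dfwith_in.
    by rewrite app_nat.
move=> R S phi t; apply: coprod_ptP => [|j|j] /=.
- by rewrite app_nat.
- by rewrite rmorph_nat.
- have [<-|ij] := eqVneq i j; first by move=> l; rewrite !dfwith_in.
  by move=> l; rewrite !dfwith_out // rmorph0.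
Defined.

Lemma cp_idem R (x : coprod R) i : cp_e x i * cp_e x i = cp_e x i.
Proof.
rewrite -[RHS]mulr1 -(cp_sum x) mulr_sumr (bigD1 i) //= big1 ?addr0 // => j ji.
by rewrite cp_orth // eq_sym.
Qed.

Lemma cp_unit R (x : coprod R) i a : a * cp_e x i = 1 -> cp_e x i = 1.
Proof. by move=> e; rewrite -e -{1}(mul1r (cp_e x i)) -{1}e -mulrA cp_idem e. Qed.

(** If [cp_e x i] is 1, orthogonality kills the other idempotents, and [cp_im] along the identity
    supplies the point. *)
Lemma coprod_inclP R (x : coprod R) i :
  (exists t, coprod_incl i R t = x) <-> cp_e x i = 1.
Proof.
split=> [[t <-] /=|e1]; first by rewrite eqxx.
have [|t [tb ty]] := @cp_im _ x i R idfun; first by [].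
have e0 j : i != j -> cp_e x j = 0.
  by move=> ij; rewrite -(mul1r (cp_e x j)) -e1 cp_orth.
exists t; apply: coprod_ptP => [|j|j l] /=.
- by rewrite ty fmap_id.
- by have [->|ji] := eqVneq j i; rewrite ?e1 // e0 // eq_sym.
- have [eij|ij] := eqVneq i j; first by subst j; rewrite dfwith_in tb.
  by rewrite dfwith_out // -cp_supp e0 // mul0r.
Qed.

Lemma coprod_incl_open i : open_immersion (coprod_incl i).
Proof.
split=> [R t t' /(congr1 (fun x : coprod R => cp_b x i)) /= e|R x].
  by apply: zerosP => l; move: e; rewrite !dfwith_in => ->.
(* An idempotent generating the unit ideal is invertible, hence equal to 1. *)
exists (fun r => r = cp_e x i) => S phi; rewrite coprod_inclP /=; split.
  move=> e J _; apply; exists (cp_e x i) => //.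
move=> /(_ (fun s => exists a, a * phi (cp_e x i) = s))[||a ha].
- split; first by exists 0; rewrite mul0r.
    by move=> _ _ [a <-] [b <-]; exists (a + b); rewrite mulrDl.
  by move=> c _ [a <-]; exists (c * a); rewrite mulrA.
- by move=> _ [_ -> <-]; exists 1; rewrite mul1r.
exact: (@cp_unit S (coprod_map phi x) i a).
Qed.

Lemma coprod_separated : separated coprod.
Proof.
move=> R x x'; have [J hJ] := ksch_sep (kschP Y) (cp_y x) (cp_y x').
exists (fun r => [\/ J r, exists i, r = cp_e x i - cp_e x' i
  | exists i l, r = cp_b x i l - cp_b x' i l]) => S phi; split.
  move=> e r [Jr|[i ->]|[i [l ->]]].
  - by apply: (proj1 (hJ S phi) _ r Jr); have := congr1 (@cp_y S) e.
  - have := congr1 (fun u => cp_e u i) e => /= ei.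
    by rewrite rmorphB /= ei subrr.
  - have := congr1 (fun u => cp_b u i l) e => /= ei.
    by rewrite rmorphB /= ei subrr.
move=> h; apply: coprod_ptP => [|i|i l] /=.
- by apply/hJ => r Jr; apply: h; constructor 1.
- apply/eqP; rewrite -subr_eq0 -rmorphB; apply/eqP/h.
  by constructor 2; exists i.
- apply/eqP; rewrite -subr_eq0 -rmorphB; apply/eqP/h.
  by constructor 3; exists i, l.
Qed.

(** The components are glued separately, [y] by the sheaf property of [Y], [e] and [b] as functions;
    the conditions relating them can be tested locally. *)
Lemma coprod_sheaf : zariski_sheaf coprod.
Proof.
move=> R m f S l uf hl x compat.
have sepR := affine_line_separated uf hl.
have [y [yE yU]] : exists! y : Y R, forall i, fmap Y (l i) y = cp_y (x i).
  apply: (ksch_sheaf (kschP Y)) uf hl _ _ => i j T u v e.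
  by have := congr1 (@cp_y T) (compat i j T u v e).
have /choice[e eE] : forall a, exists r : R, forall i, l i r = cp_e (x i) a.
  move=> a; apply: (affine_line_glue uf hl) => i j T u v h.
  by have := congr1 (fun w => cp_e w a) (compat i j T u v h).
have [b bE] : exists b : forall a, 'I_(n a) -> R,
    forall a c i, l i (b a c) = cp_b (x i) a c.
  have /choice[b bE] : forall ac : {a : I & 'I_(n a)}, exists r, forall i,
      l i r = cp_b (x i) (tag ac) (tagged ac).
    move=> [a c]; apply: (affine_line_glue uf hl) => i j T u v h.
    by have := congr1 (fun w => cp_b w a c) (compat i j T u v h).
  by exists (fun a c => b (existT _ a c)) => a c i; rewrite bE.
have im a T (phi : {lrmorphism R -> T}) : phi (e a) = 1 ->
    exists t : closed_sub (fs a) T,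
      sval t =1 (fun c => phi (b a c)) /\ g a T t = fmap Y phi y.
  move=> e1; have uT := generates_unit_image (phi := phi) uf.
  (* over each T[1/phi (f i)] the assertion is that for x i *)
  have loc (r : T) : (forall T' (psi : {lrmorphism T -> T'})
      (t : closed_sub (fs a) T'),
      sval t =1 (fun c => psi (phi (b a c))) ->
      g a T' t = fmap Y (psi \o phi) y -> psi r = 0) -> r = 0.
    move=> h; apply: (eq0_local uT) => i.
    have [[N eN]|nn] := pselect (exists N, phi (f i) ^+ N = 0).
      by exists N; rewrite eN mul0r.
    have [N eN|T' [psi [inv tors]]] := @localization_exists _ _ (phi (f i)).
      by apply: nn; exists N.
    have [//|u uE] := localization_lift (h := psi \o phi) (hl i).
    have [|t [tb ty]] := @cp_im _ (x i) a T' u.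
      rewrite -eE -[LHS]/((u \o l i) _) uE /= e1; exact: rmorph1.
    apply: tors; apply: (h _ psi t) => [c|].
      by rewrite tb -bE -[LHS]/((u \o l i) _) uE.
    by rewrite ty -yE -fmap_comp; congr fmap; apply: lrmorphP.
  have tz : zeros (fs a) (fun c => phi (b a c)).
    move=> q hq; apply: loc => T' psi [t ht] /= tb _.
    by rewrite mev_morph -(ht _ hq); apply: mev_eq => c; rewrite tb.
  exists (exist _ _ tz); split=> //.
  (* Separatedness turns equality of two points of [Y] into the vanishing of elements of [T], which
     [loc] tests locally. *)
  have [J hJ] := ksch_sep (kschP Y) (g a T (exist _ _ tz)) (fmap Y phi y).
  rewrite -[LHS]fmap_id -[RHS]fmap_id; apply/hJ => r Jr.
  apply: loc => T' psi t tb ty; move: r Jr; apply/hJ.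
  rewrite -app_nat -fmap_comp -ty; congr (g a T' _).
  by apply: zerosP => c /=; rewrite tb.
have esum : \sum_a e a = 1.
  apply: sepR => i; rewrite rmorph_sum rmorph1 -(cp_sum (x i)).
  by apply: eq_bigr => a _; rewrite /= eE.
have eorth a a' : a != a' -> e a * e a' = 0.
  by move=> aa'; apply: sepR => i; rewrite rmorphM rmorph0 /= !eE cp_orth.
have supp a c : e a * b a c = b a c.
  by apply: sepR => i; rewrite rmorphM /= eE bE cp_supp.
exists (CoprodPt esum eorth supp im); split=> [i|x' hx'].
  by apply: coprod_ptP => [|a|a c] /=; rewrite ?yE ?eE ?bE.
apply: coprod_ptP => [|a|a c] /=.
- by apply: yU => i; rewrite -hx'.
- by apply: sepR => i; rewrite eE -hx'.
- by apply: sepR => i; rewrite bE -hx'.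
Qed.

Lemma coprod_is_kscheme : is_kscheme coprod.
Proof.
split; [exact: coprod_sheaf| |exact: coprod_separated].
exists I, (fun i => Chart (coprod_incl_open i)) => K fK x.
(* Idempotents with sum 1 are not all 0, and a nonzero idempotent of a field is 1. *)
have [[i ei]|e0] := pselect (exists i, cp_e x i != 0); last first.
  case/eqP: (oner_neq0 K); rewrite -(cp_sum x) big1 // => i _.
  by apply/eqP; apply: contrapT => /negP h; apply: e0; exists i.
have [a ha] := fK _ ei; exists (Chart (coprod_incl_open i)); first by exists i.
by apply/coprod_inclP; apply: (cp_unit (a := a)); rewrite mulrC.
Qed.

(** Some idempotent lies outside the prime ideal of the local ring, so it is invertible and equals
    1: a morphism from a fat point lands in a single summand. *)
Lemma coprod_image (z : fat k) (x : pts Y z) :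
  @image_sieve _ (KScheme coprod_is_kscheme) Y coprod_proj z x <->
  exists i (y : kmor (Spec z) (closed_sub (fs i))), kcomp (g i) y = x.
Proof.
split=> [[w <-]|[i [y <-]]]; last first.
  by exists (kcomp (coprod_incl i) y); apply: kmorP.
pose x0 : coprod z := w z idfun.
have [[P hP] _] := @fat_local _ z.
have [i ei] : exists i, ~ P (cp_e x0 i).
  apply: contrapT => h; have [[P0 PD _] P1 _] := hP; apply: P1.
  rewrite -(cp_sum x0); elim/big_ind: _ => // i _.
  by apply: contrapT => hi; apply: h; exists i.
have [a ha] := unique_prime_unit (@fat_local _ z) hP ei.
have /coprod_inclP[t tE] : cp_e x0 i = 1.
  by apply: (cp_unit (a := a)); rewrite mulrC.
exists i, (point_mor t); apply: yoneda.
rewrite -[LHS]/(g i z (point_mor t z idfun)) point_morE.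
by rewrite -[RHS]/(cp_y x0) -tE.
Qed.

End Coproduct.

(** * The Frobenius motif and the action of [nabla] on sieves *)

Section FrobeniusMotif.
Variables (k : fieldType) (p : nat) (pchark : p \in [pchar k]).
Hypothesis perfect : forall a : k, exists b : k, b ^+ p = a.
Implicit Types (Y : kscheme k) (z : fat k).
Local Notation frob := (frob_fat pchark perfect).
Local Notation nabla := (nabla pchark perfect).

(* The closed point of Spec R lies in some chart, and an open subscheme
   containing the closed point of a local scheme is everything. *)
Lemma local_point_in_chart (X : kfunctor k) (C : chart X -> Prop)
    (R : comAlgType k) (x : X R) : covers C -> unique_prime R ->
  exists2 c, C c & exists t, chart_map c R t = x.
Proof.
move=> covC uR; have [[P hP] _] := uR.
have [K [pi [fK kerpi]]] := residue_field uR hP.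
have [c Cc hc] := covC K fK (fmap X pi x); exists c => //.
have [_ /(_ R x)[J hJ]] := chart_open c.
suff [t tE] : exists t, chart_map c R t = fmap X idfun x.
  by exists t; rewrite tE fmap_id.
apply/hJ => D [D0 DD DM] hD.
(* If [J] were inside [P], its image in the residue field would be 0 and could not generate the unit
   ideal, against the choice of [c]. *)
have [r [Jr nPr]] : exists r, J r /\ ~ P r.
  apply: contrapT => nex; have /hJ uK := hc.
  suff /eqP : (1 : K) = 0 by rewrite oner_eq0.
  apply: (uK (fun s => s = 0)) => [|_ [r Jr <-]].
    by split=> [//|a b -> ->|a b ->]; rewrite ?addr0 ?mulr0.
  by apply/kerpi; apply: contrapT => nPr; apply: nex; exists r.
have [s <-] := unique_prime_unit uR hP nPr.
by rewrite mulrC; apply: DM; apply: hD; exists r.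
Qed.

Lemma frob_ptsE Y z (y : pts Y (frob z)) :
  frob_pts y z idfun = fmap Y (frob_incl pchark perfect z) (y (frob z) idfun).
Proof. by rewrite -app_nat; congr (y _ _); apply: lrmorphP. Qed.

(** By separatedness, [y] and [y'] agree once certain elements of the subalgebra of p-th powers
    vanish. These vanish in the whole algebra, into which the subalgebra injects. *)
Lemma frob_pts_inj Y z : injective (@frob_pts k p pchark perfect Y z).
Proof.
move=> y y' e; apply: yoneda.
have {}e : frob_pts y z idfun = frob_pts y' z idfun by rewrite e.
have [J hJ] := ksch_sep (kschP Y) (y (frob z) idfun) (y' (frob z) idfun).
rewrite -[LHS]fmap_id -[RHS]fmap_id; apply/hJ => r Jr.
apply: (@frob_incl_inj _ _ pchark perfect z); rewrite [RHS]rmorph0.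
by move: r Jr; apply/hJ; rewrite -!frob_ptsE.
Qed.

Lemma frob_pts_nat Y z z' (a : fatmor z' z) (y : pts Y (frob z)) :
  frob_pts (kcomp y (frob_fatmor pchark perfect a)) = kcomp (frob_pts y) a.
Proof. by rewrite /frob_pts -!kcompA frob_unit_nat. Qed.

Lemma frob_pts_comp Y Y' z (g : kmor Y Y') (y : pts Y (frob z)) :
  @frob_pts _ _ _ _ Y' z (kcomp g y) = kcomp g (frob_pts y).
Proof. exact/esym/kcompA. Qed.

Lemma mev_frob_eqs n (R : comAlgType k) (b : 'I_n -> R) (f : {mpoly k[n]}) :
  mev b (f \mPo [tuple 'X_i ^+ p | i < n]) = mev (fun i => b i ^+ p) f.
Proof.
rewrite mev_comp; apply: mev_eq => i.
by rewrite tnth_mktuple /mev rmorphXn /= -/(mev b _) mevX.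
Qed.

Lemma frob_motifP Y (C : chart Y -> Prop) z (x : pts Y z) : covers C ->
  frob_motif p C z x <-> exists y : pts Y (frob z), frob_pts y = x.
Proof.
move=> covC; split=> [[c Cc [b <-]]|[y <-]].
  pose a i := frob_elt pchark perfect (sval (b z idfun) i).
  have za : zeros (chart_eqs c) a.
    move=> f hf; apply: frob_incl_inj; rewrite mev_morph [RHS]rmorph0.
    exact: (frob_eqs_zeros (svalP (b z idfun)) hf).
  exists (point_mor (chart_map c (frob z) (exist _ a za))); apply: yoneda.
  rewrite frob_ptsE point_morE -app_nat; congr (chart_map c z _).
  exact: zerosP.
have [c Cc [[a za] ta]] :=
  local_point_in_chart (y (frob z) idfun) covC (@fat_local _ (frob z)).
(* Any choice of p-th roots will do, since [power_mor] sees only their p-th powers. *)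
have /choice[b bE] := fun i => frob_eltP (a i).
have zb : zeros (frob_eqs p (chart_eqs c)) b.
  move=> _ /mapP[f hf ->]; rewrite mev_frob_eqs.
  have := congr1 (frob_incl pchark perfect z) (za f hf).
  rewrite mev_morph [RHS]rmorph0 => <-.
  by apply: mev_eq => i /=; rewrite bE.
exists c => //; exists (point_mor (exist _ b zb : closed_sub _ z)).
apply: yoneda; rewrite frob_ptsE -ta -app_nat; congr (chart_map c z _).
by apply: zerosP => i /=; rewrite bE.
Qed.

Lemma frob_motif_sub_schemic Y (C : chart Y -> Prop) : covers C ->
  sub_schemic (frob_motif p C).
Proof.
move=> covC; have [I [c covc]] := ksch_cover (kschP Y).
pose g i := kcomp (chart_map (c i)) (power_mor p (chart_eqs (c i))).
exists (KScheme (coprod_is_kscheme g)), (coprod_proj g); apply: sieveP => z x.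
(* Both coverings describe the image of Y(Fz), so [C] may be exchanged for the finite covering
   [c]. *)
rewrite coprod_image (frob_motifP _ covC) -(frob_motifP _ covc) /=.
split=> [[_ [i <-] [y <-]]|[i [y <-]]]; first by exists i, y; rewrite -kcompA.
by exists (c i); [exists i|exists y; rewrite kcompA].
Qed.

Lemma nabla_sub_schemic Y (A : sieve Y) :
  sub_schemic A -> sub_schemic (nabla A).
Proof.
move=> [X [phi ->]].
have covX : covers (fun _ : chart X => True).
  have [I [c covc]] := ksch_cover (kschP X) => K fK x.
  by have [d _ hd] := covc K fK x; exists d.
have [X' [psi E]] := frob_motif_sub_schemic covX.
exists X', (kcomp phi psi); apply: sieveP => z x /=; split.
  move=> [_ [u <-] <-]; rewrite frob_pts_comp.
  have : frob_motif p (fun _ : chart X => True) z (frob_pts u).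
    by apply/(frob_motifP _ covX); exists u.
  by rewrite E => -[v <-]; exists v; rewrite kcompA.
move=> [v <-]; have : image_sieve psi z (kcomp psi v) by exists v.
rewrite -E => /(frob_motifP _ covX)[u uE].
by exists (kcomp phi u); [exists u|rewrite frob_pts_comp uE kcompA].
Qed.

(** The approximation is taken at [frob z], because [nabla B] at [z] depends only on [B] at
    [frob z]. *)
Lemma nabla_formal Y (A : sieve Y) : formal A -> formal (nabla A).
Proof.
move=> hA z; have [B [sB BA eB]] := hA (frob z); exists (nabla B); split.
- exact: nabla_sub_schemic.
- by move=> w _ [y hy <-]; exists y => //; apply: BA.
- by move=> x; split=> -[y hy <-]; exists y => //; apply/eB.
Qed.

Lemma nabla_cup Y (A B : sieve Y) :
  nabla (sieve_cup A B) = sieve_cup (nabla A) (nabla B).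
Proof.
apply: sieveP => z x /=; split=> [[y [hy|hy] <-]|[[y hy <-]|[y hy <-]]].
- by left; exists y.
- by right; exists y.
- by exists y => //; left.
- by exists y => //; right.
Qed.

(** The two preimages of a common point coincide because [frob_pts] is injective. *)
Lemma nabla_cap Y (A B : sieve Y) :
  nabla (sieve_cap A B) = sieve_cap (nabla A) (nabla B).
Proof.
apply: sieveP => z x /=; split=> [[y [hA hB] <-]|[[y hA <-] [y' hB]]].
  by split; exists y.
by move=> /frob_pts_inj e; exists y => //; split=> //; rewrite -e.
Qed.

Lemma nabla_prod X Y (A : sieve X) (B : sieve Y) :
  nabla (sieve_prod A B) = sieve_prod (nabla A) (nabla B).
Proof.
apply: sieveP => z x /=; split=> [[y [hA hB] <-]|[[u hA uE] [v hB vE]]].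
  split; [exists (kcomp (fstf X Y) y)|exists (kcomp (sndf X Y) y)] => //.
    exact: (@frob_pts_comp (kprod X Y) X).
  exact: (@frob_pts_comp (kprod X Y) Y).
exists (pairf u v); first by rewrite fst_pair snd_pair.
apply: kmorP => R t; rewrite [RHS]surjective_pairing.
rewrite -[(x R t).1]/(kcomp (fstf X Y) x R t) -uE.
by rewrite -[(x R t).2]/(kcomp (sndf X Y) x R t) -vE.
Qed.

Lemma nabla_full_point : nabla (sieve_full (kpoint k)) = sieve_full (kpoint k).
Proof.
apply: sieveP => z x; split=> // _.
pose y : pts (kpoint k) (frob z) :=
  @KMor _ (Spec (frob z)) (pointf k) (fun _ _ => tt) (fun _ _ _ _ => erefl).
by exists y => //; apply: kmorP => R t; case: (x R t).
Qed.

(** [h] is [f] at [frob z] transported along the bijection of A(Fz) with the value of [nabla A] at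
    [z]. Allowing any preimage [y] of [w] makes the inverse laws in [nabla_iso] direct. *)
Lemma nabla_mor X Y (A : sieve X) (B : sieve Y) (f : sieve_mor A B) :
  exists h : sieve_mor (nabla A) (nabla B), forall z y w,
    sval w = frob_pts (sval y) -> sval (h z w) = frob_pts (sval (f (frob z) y)).
Proof.
have lift z (w : {x | nabla A z x}) :
    {y : {y | A (frob z) y} | frob_pts (sval y) = sval w}.
  by have [y hy yE] := cid2 (svalP w); exists (exist _ y hy).
have hB z (w : {x | nabla A z x}) :
    nabla B z (frob_pts (sval (f _ (sval (lift z w))))).
  by eexists; first exact: (svalP (f _ (sval (lift z w)))).
pose h z w : {x | nabla B z x} := exist _ _ (hB z w).
have hE z y w : sval w = frob_pts (sval y) ->
    sval (h z w) = frob_pts (sval (f (frob z) y)).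
  move=> e /=; congr (frob_pts (sval (f _ _))); apply: sieve_sigP.
  by apply: frob_pts_inj; rewrite -e; apply: (svalP (lift z w)).
have nat z z' (a : fatmor z' z) (w : {x | nabla A z x}) :
    sval (h z' (exist _ _ (smem_comp a (svalP w)))) = kcomp (sval (h z w)) a.
  have [y yE] := lift z w; rewrite (hE _ _ _ (esym yE)).
  rewrite -frob_pts_nat -sapp_nat; apply: hE.
  by rewrite /= frob_pts_nat yE.
by exists (SieveMor nat).
Qed.

Lemma nabla_iso X Y (A : sieve X) (B : sieve Y) :
  sieve_iso A B -> sieve_iso (nabla A) (nabla B).
Proof.
move=> [f [g [gf fg]]]; have [f' fE] := nabla_mor f.
have [g' gE] := nabla_mor g; exists f', g'.
split=> z w; have [y hy yE] := svalP w; apply: sieve_sigP; rewrite -yE.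
  have e : sval w = frob_pts (sval (exist _ y hy)) by [].
  by rewrite (gE _ _ _ (fE _ _ _ e)) gf.
have e : sval w = frob_pts (sval (exist _ y hy)) by [].
by rewrite (fE _ _ _ (gE _ _ _ e)) fg.
Qed.

End FrobeniusMotif.

(** * Endomorphisms of Gr(M) induced by operations on sieves *)

Section GrothendieckEndomorphism.
Variables (k : fieldType) (M : motif_class k).
Variable T : forall Y : kscheme k, sieve Y -> sieve Y.
Arguments T {Y}.
Hypothesis TM : forall (Y : kscheme k) (A : sieve Y), M Y A -> M Y (T A).

Fixpoint gr_map (x : gr M) : gr M :=
  match x with
  | gr_sym a => gr_sym (Motif (TM (motifP a)))
  | gr_zero => gr_zero M
  | gr_add x1 x2 => gr_add (gr_map x1) (gr_map x2)
  | gr_opp x1 => gr_opp (gr_map x1)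
  end.

Lemma induced_endomorphism :
  (forall Y (A B : sieve Y), T (sieve_cup A B) = sieve_cup (T A) (T B)) ->
  (forall Y (A B : sieve Y), T (sieve_cap A B) = sieve_cap (T A) (T B)) ->
  (forall X Y (A : sieve X) (B : sieve Y),
     T (sieve_prod A B) = sieve_prod (T A) (T B)) ->
  T (sieve_full (kpoint k)) = sieve_full (kpoint k) ->
  (forall X Y (A : sieve X) (B : sieve Y),
     sieve_iso A B -> sieve_iso (T A) (T B)) ->
  induces_endomorphism M (@T).
Proof.
move=> Tcup Tcap Tprod Tone Tiso; exists gr_map; last first.
  by move=> Y A hA; exists (TM hA); apply: gr_refl.
split=> [a b||a b|].
- elim=> {a b} /=.
  + by move=> a; apply: gr_refl.
  + by move=> a b _; apply: gr_symm.
  + by move=> a b c _ h1 _ h2; apply: gr_trans h1 h2.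
  + by move=> *; apply: gr_addE.
  + by move=> *; apply: gr_oppE.
  + by move=> *; apply: gr_addA.
  + by move=> *; apply: gr_addC.
  + by move=> *; apply: gr_add0.
  + by move=> *; apply: gr_addN.
  (* [Tcup] and [Tcap] are equalities, not conversions, hence the generalized scissor relation. *)
  + by move=> X A B hA hB hU hI; apply: gr_scissor_gen.
  + by move=> X Y A B hA hB h; apply: gr_iso; apply: Tiso.
- by move=> a b; apply: gr_refl.
(* Products are defined by recursion on expressions, which leaves the case of two symbols, settled
   by [Tprod]. *)
- elim: a => [a||a1 h1 a2 h2|a h] /=; [|exact: gr_refl|exact: gr_addE|
    exact: gr_oppE].
  elim: b => [b||b1 h1 b2 h2|b h] /=; [|exact: gr_refl|exact: gr_addE|
    exact: gr_oppE].
  exact: gr_sym_eq.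
- exact: gr_sym_eq.
Qed.

End GrothendieckEndomorphism.

(** * The Frobenius adjunction and its endomorphisms *)

Theorem theorem8p14 (k : fieldType) (p : nat) (pchark : p \in [pchar k])
    (perfect : forall a : k, exists b : k, b ^+ p = a)
    (C : forall Y : kscheme k, chart Y -> Prop)
    (coverC : forall Y : kscheme k, covers (C Y)) :
  [/\ exists2 theta : forall (Y : kscheme k) (z : fat k),
          pts Y (frob_fat pchark perfect z) ->
          {y : pts Y z | frob_motif p (C Y) z y},
        sub_schemic_adjunction (@frob_fatmor k p pchark perfect) theta
      & forall (Y : kscheme k) (z : fat k)
          (y : pts Y (frob_fat pchark perfect z)),
          sval (theta Y z y) = frob_pts y,
      induces_endomorphism (subSch k) (@nabla k p pchark perfect)
    & induces_endomorphism (Form k) (@nabla k p pchark perfect)].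
Proof.
have motifE (Y : kscheme k) z (x : pts Y z) :=
  frob_motifP pchark perfect x (coverC Y).
split; last 2 first.
- apply: induced_endomorphism; [exact: nabla_sub_schemic|exact: nabla_cup|
    exact: nabla_cap|exact: nabla_prod|exact: nabla_full_point|
    exact: nabla_iso].
- apply: induced_endomorphism; [exact: nabla_formal|exact: nabla_cup|
    exact: nabla_cap|exact: nabla_prod|exact: nabla_full_point|
    exact: nabla_iso].
pose theta (Y : kscheme k) z (y : pts Y (frob_fat pchark perfect z)) :
    {x : pts Y z | frob_motif p (C Y) z x} :=
  exist _ (frob_pts y) (proj2 (motifE Y z _) (ex_intro _ y erefl)).
exists theta => //; split=> /=.
- move=> z; apply: kmorP => R h; apply: lrmorphP => t /=.
  by congr (h _); apply: frob_incl_inj.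
- move=> z1 z2 z3 a b; apply: kmorP => R h; apply: lrmorphP => t /=.
  congr (h _); apply: frob_incl_inj.
  (* Naturality of [b] along the homomorphism of [a]. *)
  have e : Spec_hom (kcomp b a) = fmap (Spec z3) (Spec_hom a) (Spec_hom b).
    by rewrite /Spec_hom -app_nat; congr (b _ _); apply: lrmorphP.
  exact: (congr1 (fun q : Spec z3 z1 => q (frob_incl pchark perfect z3 t)) e).
- by move=> Y; apply: (frob_motif_sub_schemic pchark perfect (coverC Y)).
- move=> Y Y' g z y /motifE[u <-]; apply/motifE.
  by exists (kcomp g u); rewrite frob_pts_comp.
(* A right inverse comes from choice, the motif being the image of Y(Fz); it is also a left inverse
   because [frob_pts] is injective. *)
- move=> Y z; have /choice[inv invE] : forall x : {x | frob_motif p (C Y) z x},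
      exists y, theta Y z y = x.
    by move=> x; have /motifE[y yE] := svalP x; exists y; apply: sieve_sigP.
  exists inv => [y|//]; apply: (@frob_pts_inj _ _ pchark perfect).
  by have := congr1 sval (invE (theta Y z y)).
- by move=> *; apply: frob_pts_nat.
- by move=> *; apply: frob_pts_comp.
Qed.
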